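(* The development of the edge of regression $\mathcal{R}$ of the extended oloid $\mathcal{O}$ onto $E$ is the curve $$\mathcal{R}^*=\{(g_1^*(t),g_2^*(t)): t\in\mathbb{R}\}$$ (values of $t$ with $\cos h(t)=0$ being excluded) with parametrization $$g_1^*(t)=\operatorname{sgn}(t)\left\lfloor\frac{3|t|}{4\pi}+\frac12\right\rfloor\frac{4\pi}{3\sqrt3}+\operatorname{sgn}(h(t))\,\tilde g_1(h(t)),\qquad g_2^*(t)=\tilde g_2(h(t)),$$ where, with $c=\cos t$, $s=\sin t$, $$\tilde g_1(t)=\frac{2\sqrt3}9\left(\arccos\frac{\sqrt2\,c}{\sqrt{1+c}}-\frac{(2+2c-c^2)\sqrt{2(1+2c)}\,|s|}{3c(1+c)^{3/2}}\right),$$ $$\tilde g_2(t)=\frac{\sqrt3}9\left(\ln\frac2{1+c}+\frac{7+33c+18c^2-4c^3}{3c(1+c)}\right),$$ and $$h(t)=t-\operatorname{sgn}(t)\left\lfloor\frac{3|t|}{4\pi}+\frac12\right\rfloor\frac{4\pi}3.$$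
   Context: $\lfloor\cdot\rfloor$ denotes the integer part. The extended oloid $\mathcal{O}$ is the developable surface containing the surface of the convex hull of the circles $k_A: x^2+(y+\frac12)^2=1, z=0$ and $k_B:(y-\frac12)^2+z^2=1, x=0$; it is the union of the generating lines $x=\omega_1(m,t)$, $y=\omega_2(m,t)$, $z=\pm\omega_3(m,t)$, $m\in\mathbb{R}$, for $t\in[-\frac{2\pi}3,\frac{2\pi}3]$, where $$\omega_1=(1-m)\sin t,\quad \omega_2=(1-m)\left(-\tfrac12-\cos t\right)+m\left(\tfrac12-\tfrac{\cos t}{1+\cos t}\right),\quad \omega_3=\frac{m\sqrt{1+2\cos t}}{1+\cos t}.$$ The edge of regression $\mathcal{R}$ of $\mathcal{O}$ (the curve to which all generating lines of $\mathcal{O}$ are tangent) is given by $x=\frac{\sin t-\tan t}3$, $y=\frac{2+3\cos t-3\cos^2t-2\cos^3t}{6(1+\cos t)\cos t}$, $z=\pm\frac{(1+2\cos t)^{3/2}}{3(1+\cos t)\cos t}$, $t\in[-\frac{2\pi}3,\frac{2\pi}3]$, $t\neq\pm\frac\pi2$, the point with parameter $t$ and sign $\pm$ lying on the generating line $(\omega_1,\omega_2,\pm\omega_3)(\cdot,t)$. Development: let $E$ be the plane tangent to $\mathcal{O}$ along the generating line $\mathcal{L}_0=\{(\omega_1(m,0),\omega_2(m,0),-\omega_3(m,0)): m\in\mathbb{R}\}$, with a Cartesian $\xi,\eta$-coordinate system in which $\mathcal{L}_0$ is the $\eta$-axis (oriented in the direction of increasing $m$) and the line perpendicular to $\mathcal{L}_0$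 through the point $m=0$ is the $\xi$-axis (oriented so that the generating lines for small $t>0$ are developed to $\xi>0$ near the origin). The surface $\mathcal{O}$ is developed (unrolled isometrically, each generating line being mapped isometrically onto a line of $E$) onto $E$, starting from $\mathcal{L}_0$, which is kept fixed, and continuing indefinitely in both directions. The parameter $t\in\mathbb{R}$ labels the successive generating lines in this process: for $t\in[-\frac{2\pi}3,\frac{2\pi}3]$ it is the line $\{(\omega_1,\omega_2,-\omega_3)(m,t):m\in\mathbb{R}\}$, for $t\in[\frac{2\pi}3,2\pi]$ it is the line $\{(\omega_1,\omega_2,\omega_3)(m,\frac{4\pi}3-t):m\in\mathbb{R}\}$, and this is continued periodically with period $\frac{8\pi}3$. ($t$ is the arc length along a circular arc of $k_A$.) The development of a curve on $\mathcal{O}$ is its image under this process. *)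

(* Defs.v *)
(* Stdlib reals with Coquelicot. *)
From Stdlib Require Import Reals.
From Coquelicot Require Import Coquelicot.
Open Scope R_scope.

Definition dot2 (v w : R * R) : R := fst v * fst w + snd v * snd w.

Definition det2 (v w : R * R) : R := fst v * snd w - snd v * fst w.

Definition dot3 (v w : R * R * R) : R :=
  let '(v1, v2, v3) := v in let '(w1, w2, w3) := w in
  v1 * w1 + v2 * w2 + v3 * w3.

Definition cross (v w : R * R * R) : R * R * R :=
  let '(v1, v2, v3) := v in let '(w1, w2, w3) := w in
  (v2 * w3 - v3 * w2, v3 * w1 - v1 * w3, v1 * w2 - v2 * w1).

Definition det3 (u v w : R * R * R) : R := dot3 (cross u v) w.

Definition omega1 (m t : R) : R := (1 - m) * sin t.

Definition omega2 (m t : R) : R :=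
  (1 - m) * (- (1 / 2) - cos t) + m * (1 / 2 - cos t / (1 + cos t)).

Definition omega3 (m t : R) : R := m * sqrt (1 + 2 * cos t) / (1 + cos t).

(* The generating lines are labelled by all real t, with period 8 PI / 3.
   [reduced t] is the representative of t in [-2 PI / 3, 2 PI).  The line with
   label t is (omega1, omega2, zsign t * omega3) at parameter [param t], and
   [param t] always lies in [-2 PI / 3, 2 PI / 3]. *)
Definition reduced (t : R) : R :=
  t - IZR (floor ((t + 2 * PI / 3) / (8 * PI / 3))) * (8 * PI / 3).

Definition zsign (t : R) : R :=
  if Rle_dec (reduced t) (2 * PI / 3) then -1 else 1.

Definition param (t : R) : R :=
  if Rle_dec (reduced t) (2 * PI / 3) then reduced t
  else 4 * PI / 3 - reduced t.

Definition surface (m t : R) : R * R * R :=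
  (omega1 m (param t), omega2 m (param t), zsign t * omega3 m (param t)).

(* The point of the edge of regression with parameter t in
   [-2 PI / 3, 2 PI / 3] and sign e.  The power 3/2 is a cubed square root, not
   [Rpower], because the base vanishes at t = +-2 PI / 3 and
   [Rpower 0 (3 / 2)] is 1. *)
Definition edge_point (e t : R) : R * R * R :=
  ((sin t - tan t) / 3,
   (2 + 3 * cos t - 3 * cos t ^ 2 - 2 * cos t ^ 3)
     / (6 * (1 + cos t) * cos t),
   e * (sqrt (1 + 2 * cos t) ^ 3 / (3 * (1 + cos t) * cos t))).

(* The edge point lying on the generating line with label t. *)
Definition edge (t : R) : R * R * R := edge_point (zsign t) (param t).

Definition edge_defined (t : R) : Prop :=
  param t <> PI / 2 /\ param t <> - (PI / 2).

(* The tangent plane of a developable surface is constant along each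
   generating line, so a unit normal depends on t only. *)
Record unit_normal_field (N : R -> R * R * R) : Prop := {
  normal_continuous : forall t, continuous N t;
  normal_unit : forall t, dot3 (N t) (N t) = 1;
  normal_along : forall m t v,
    is_derive (fun m' => surface m' t) m v -> dot3 (N t) v = 0;
  normal_across : forall m t v,
    is_derive (fun t' => surface m t') t v -> dot3 (N t) v = 0 }.

(* An orthonormal basis of the directions of E.  The third vector n is the
   normal of the surface along the initial line, so E is the tangent plane
   there.  The origin of the coordinates on E is [surface 0 0]. *)
Record plane_frame (e_xi e_eta n : R * R * R) : Prop := {
  frame_xi : dot3 e_xi e_xi = 1;
  frame_eta : dot3 e_eta e_eta = 1;
  frame_orth : dot3 e_xi e_eta = 0;
  frame_normal : n = cross e_xi e_eta;
  frame_axis : exists l : R, 0 < l /\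
    forall m, minus (surface m 0) (surface 0 0) = scal (l * m) e_eta }.

(* [D m t] is the pair of (xi, eta)-coordinates of the development of the
   point [surface m t].

   [dev_line]: Coquelicot's norm on products is the Euclidean norm.

   [dev_isometric]: D preserves the first fundamental form at every point at
   which the parametrization is differentiable.  The only labels at which it
   is not are those with [param t] = +-2 PI / 3, where dz/dt is infinite (or,
   for m = 0, the circular arc is traversed backwards from there on).  The
   condition on determinants says that the plane is not folded along a
   generating line; as N is continuous, it also forbids a fold at these
   exceptional lines, where D is only required to be continuous. *)
Record is_development (e_xi e_eta : R * R * R) (N : R -> R * R * R)
    (D : R -> R -> R * R) : Prop := {
  dev_continuous : forall p : R * R,
    continuous (fun q : R * R => D (fst q) (snd q)) p;
  dev_line : forall m m' t,
    norm (minus (D m t) (D m' t)) = norm (minus (surface m t) (surface m' t));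
  dev_isometric : forall m t Xm Xt,
    is_derive (fun m' => surface m' t) m Xm ->
    is_derive (fun t' => surface m t') t Xt ->
    exists Dm Dt : R * R,
      is_derive (fun m' => D m' t) m Dm /\
      is_derive (fun t' => D m t') t Dt /\
      dot2 Dm Dm = dot3 Xm Xm /\
      dot2 Dm Dt = dot3 Xm Xt /\
      dot2 Dt Dt = dot3 Xt Xt /\
      det2 Dm Dt = det3 Xm Xt (N t);
  dev_fixed : forall m,
    surface m 0 =
    plus (surface 0 0)
      (plus (scal (fst (D m 0)) e_xi) (scal (snd (D m 0)) e_eta));
  dev_side : exists d : R, 0 < d /\
    forall m t, Rabs m < d -> 0 < t < d -> 0 < fst (D m t) }.

Definition developed_edge (D : R -> R -> R * R) (p : R * R) : Prop :=
  exists m t, edge_defined t /\ surface m t = edge t /\ p = D m t.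

Definition turns (t : R) : R :=
  sign t * IZR (floor (3 * Rabs t / (4 * PI) + 1 / 2)).

Definition h (t : R) : R := t - turns t * (4 * PI / 3).

Definition g1_tilde (t : R) : R :=
  let c := cos t in let s := sin t in
  2 * sqrt 3 / 9 *
    (acos (sqrt 2 * c / sqrt (1 + c))
     - (2 + 2 * c - c ^ 2) * sqrt (2 * (1 + 2 * c)) * Rabs s
         / (3 * c * sqrt (1 + c) ^ 3)).

Definition g2_tilde (t : R) : R :=
  let c := cos t in
  sqrt 3 / 9 *
    (ln (2 / (1 + c))
     + (7 + 33 * c + 18 * c ^ 2 - 4 * c ^ 3) / (3 * c * (1 + c))).

Definition g1_star (t : R) : R :=
  turns t * (4 * PI / (3 * sqrt 3)) + sign (h t) * g1_tilde (h t).

Definition g2_star (t : R) : R := g2_tilde (h t).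

(* Main.v *)
Require Import Defs.
From Stdlib Require Import Reals Ranalysis5 Lra Lia ZArith.
From Coquelicot Require Import Coquelicot.
Open Scope R_scope.

(** A development is determined by the metric of the surface, so it suffices to
    find one explicit map with the right first fundamental form and to prove
    uniqueness.

    Along a generating line the surface is affine with speed sqrt 3, and a
    distance preserving map of a line into the plane is affine, so
    D(m, t) = A(t) + m V(t) with |V| = sqrt 3 ([dev_affine]).  The isometry
    conditions give the scalar product and the determinant of V with the
    t-derivative of D; together they say that V rotates at a prescribed speed
    and that the derivative of A is a prescribed linear function of V
    ([is_derive_development]).  The sign of the determinant depends on the side
    to which N points.  By continuity this is the same side for all t
    ([normal_orientation]), and the requirement that the lines for small
    positive t go to xi > 0 tells which one ([initial_orientation]).

    The differential equations have an explicit solution ([dev_direction],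
    [dev_circle]) for |t| <= 2 PI / 3.  The rotation angle is a combination of
    an arccosine and an arcsine, but its sine and cosine are algebraic in
    sin t, cos t and square roots; the arccosine and the logarithm of the final
    formula come from integrating A.  Uniqueness needs no general theorem on
    differential equations: two vectors that rotate at the same speed have a
    constant scalar product ([developed_ruling]), and then two curves with the
    same derivative differ by a constant ([developed_circle]).

    A half turn of space carries each sector of 4 PI / 3 labels to the next
    one.  The ruling returns to the same direction after a sector while A is
    translated by 4 PI / (3 sqrt 3) along the xi-axis ([dev_circle_glue]).  On
    the border lines between sectors the surface is not differentiable in t, so
    the equations hold only inside, and the sectors are joined by continuity
    ([continuation]).

    The edge of regression meets the line t at the parameter at which the
    partial derivatives of the surface are linearly dependent,
    m = (1 + 2 cos t) / (3 cos t); putting this into A + m V gives the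
    formula ([developed_edge_formula]). *)

(** * Calculus for pairs and on intervals *)

Lemma is_derive_fst {V W : NormedModule R_AbsRing} (f : R -> V * W) (x : R)
    (l : V * W) :
  is_derive f x l -> is_derive (fun y => fst (f y)) x (fst l).
Proof.
  intros Hf.
  apply filterdiff_ext_lin with (fun y => fst (scal y l)); [|reflexivity].
  apply (filterdiff_comp f fst _ fst Hf).
  apply filterdiff_linear, is_linear_fst.
Qed.

Lemma is_derive_snd {V W : NormedModule R_AbsRing} (f : R -> V * W) (x : R)
    (l : V * W) :
  is_derive f x l -> is_derive (fun y => snd (f y)) x (snd l).
Proof.
  intros Hf.
  apply filterdiff_ext_lin with (fun y => snd (scal y l)); [|reflexivity].
  apply (filterdiff_comp f snd _ snd Hf).
  apply filterdiff_linear, is_linear_snd.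
Qed.

Lemma is_derive_pair {V W : NormedModule R_AbsRing} (f : R -> V) (g : R -> W)
    (x : R) (lf : V) (lg : W) :
  is_derive f x lf -> is_derive g x lg ->
  is_derive (fun y => (f y, g y)) x (lf, lg).
Proof.
  intros Hf Hg.
  apply filterdiff_ext_lin with (fun y => (scal y lf, scal y lg));
    [|reflexivity].
  apply (filterdiff_comp'_2 f g (fun a b => (a, b)) x _ _ (fun a b => (a, b))
    Hf Hg).
  apply filterdiff_ext with (fun u => u); [now intros []|].
  apply filterdiff_ext_lin with (fun u => u); [|now intros []].
  apply filterdiff_id.
Qed.

Lemma continuous_fst_comp {T U V : UniformSpace} (f : T -> U * V) (x : T) :
  continuous f x -> continuous (fun y => fst (f y)) x.
Proof.
  intros Hf. apply (continuous_comp f fst); [exact Hf|].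
  destruct (f x); apply continuous_fst.
Qed.

Lemma continuous_snd_comp {T U V : UniformSpace} (f : T -> U * V) (x : T) :
  continuous f x -> continuous (fun y => snd (f y)) x.
Proof.
  intros Hf. apply (continuous_comp f snd); [exact Hf|].
  destruct (f x); apply continuous_snd.
Qed.

Lemma zero_derivative_constant (f : R -> R) (a b : R) :
  (forall x, a < x < b -> is_derive f x 0) ->
  (forall x, a <= x <= b -> continuous f x) ->
  forall x y, a <= x <= b -> a <= y <= b -> f x = f y.
Proof.
  intros Hd Hc x y Hx Hy.
  destruct (MVT_gen f x y (fun _ => 0)) as [c [_ Hf]]; [| |lra].
  - intros z Hz. apply Hd.
    unfold Rmin, Rmax in Hz; destruct (Rle_dec x y); lra.
  - intros z Hz. apply continuity_pt_filterlim, Hc.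
    unfold Rmin, Rmax in Hz; destruct (Rle_dec x y); lra.
Qed.

Lemma continuous_limit_const (f : R -> R) (a b c x : R) : a < b ->
  (forall y, a < y < b -> f y = c) -> a <= x <= b ->
  continuous f x -> f x = c.
Proof.
  intros Hab Hf Hx Hc.
  destruct (Req_dec (f x) c) as [|Hne]; [assumption|exfalso].
  assert (He : 0 < Rabs (f x - c)) by (apply Rabs_pos_lt; lra).
  destruct (proj1 (filterlim_locally f (f x)) Hc (mkposreal _ He)) as [d Hd].
  assert (Hd0 := cond_pos d).
  assert (Hy : exists y, a < y < b /\ Rabs (y - x) < d).
  { destruct (Rlt_dec x b) as [Hxb|Hxb].
    - exists (x + Rmin (d / 2) ((b - x) / 2)).
      unfold Rmin; destruct (Rle_dec (d / 2) ((b - x) / 2));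
        rewrite Rabs_pos_eq; lra.
    - exists (x - Rmin (d / 2) ((b - a) / 2)).
      unfold Rmin; destruct (Rle_dec (d / 2) ((b - a) / 2));
        rewrite Rabs_left1; lra. }
  destruct Hy as [y [Hy Hyx]].
  specialize (Hd y Hyx). change (Rabs (f y - f x) < Rabs (f x - c)) in Hd.
  rewrite (Hf y Hy), Rabs_minus_sym in Hd. lra.
Qed.

(** A continuous function with values in {1, -1} cannot jump.  The values at
    the end points are not assumed to be signs, because the unit normal is
    characterised by differentiation only in the interior of a sector. *)
Lemma continuous_sign_constant (f : R -> R) (a b : R) : a < b ->
  (forall x, a < x < b -> f x * f x = 1) ->
  (forall x, a <= x <= b -> continuous f x) ->
  forall x y, a <= x <= b -> a <= y <= b -> f x = f y.
Proof.
  intros Hab Hsq Hc.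
  assert (Hsq' : forall x, a <= x <= b -> f x * f x = 1).
  { intros x Hx.
    apply (continuous_limit_const (fun z => f z * f z) a b 1 x Hab Hsq Hx).
    apply (continuous_mult f f); now apply Hc. }
  enough (H : forall x y, a <= x -> x < y -> y <= b -> f x = f y).
  { intros x y Hx Hy. destruct (Rtotal_order x y) as [Hxy|[->|Hxy]].
    - apply H; lra.
    - reflexivity.
    - symmetry; apply H; lra. }
  intros x y Hx Hxy Hy.
  assert (H1 := Hsq' x ltac:(lra)). assert (H2 := Hsq' y ltac:(lra)).
  destruct (Rlt_dec 0 (f x * f y)) as [Hpos|Hneg].
  { assert (H0 : (f x - f y) * (f x + f y) = 0) by nra.
    apply Rmult_integral in H0. destruct H0; nra. }
  exfalso.
  assert (Hlt : f x * f y < 0).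
  { assert (f x * f y <> 0); [|lra].
    intros H0. apply Rmult_integral in H0. nra. }
  assert (Hz : exists z, x <= z <= y /\ f z = 0).
  { destruct (Rlt_dec (f x) 0) as [Hfx|Hfx].
    - destruct (IVT_interv f x y) as [z Hz];
        [|lra|lra|apply Rnot_le_lt; intros Hn; nra|now exists z].
      intros z Hz. apply continuity_pt_filterlim, Hc; lra.
    - destruct (IVT_interv (fun z => - f z) x y) as [z Hz];
        [|lra|nra|nra|exists z; lra].
      intros z Hz. apply continuity_pt_opp, continuity_pt_filterlim, Hc; lra. }
  destruct Hz as [z [Hz Hfz]].
  assert (H3 := Hsq' z ltac:(lra)). rewrite Hfz in H3. lra.
Qed.

(** * The labelling of the generating lines *)

(** The labels t = k (4 PI / 3) + tau with |tau| <= 2 PI / 3 form the sector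
    k.  The half turn (x, y, z) -> (- x, y, - z) about the y-axis carries each
    sector to the next one, so k enters only through this sign. *)
Definition parity (k : Z) : R := if Z.even k then 1 else -1.

Lemma parity_succ k : parity (Z.succ k) = - parity k.
Proof.
  unfold parity. rewrite Z.even_succ, <- Z.negb_even.
  destruct (Z.even k); simpl; ring.
Qed.

Lemma parity_sqr k : parity k * parity k = 1.
Proof. unfold parity; destruct (Z.even k); ring. Qed.

Lemma floor_unique (x : R) (n : Z) : IZR n <= x < IZR n + 1 -> floor x = n.
Proof.
  intros Hn. unfold floor. destruct (floor_ex x) as [p Hp]; simpl.
  assert (IZR p < IZR (n + 1)) by (rewrite plus_IZR; lra).
  assert (IZR n < IZR (p + 1)) by (rewrite plus_IZR; lra).
  apply lt_IZR in H, H0. lia.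
Qed.

Lemma cos_Rabs x : cos (Rabs x) = cos x.
Proof. unfold Rabs; destruct (Rcase_abs x); [apply cos_neg|reflexivity]. Qed.

Lemma cos_sector_ge x : Rabs x <= 2 * PI / 3 -> - (1 / 2) <= cos x.
Proof.
  intros Hx. assert (HPI := PI_RGT_0). assert (H0 := Rabs_pos x).
  replace (- (1 / 2)) with (cos (2 * (PI / 3))) by (rewrite cos_2PI3; lra).
  rewrite <- (cos_Rabs x). apply cos_decr_1; lra.
Qed.

Lemma cos_sector_gt x : Rabs x < 2 * PI / 3 -> - (1 / 2) < cos x.
Proof.
  intros Hx. assert (HPI := PI_RGT_0). assert (H0 := Rabs_pos x).
  replace (- (1 / 2)) with (cos (2 * (PI / 3))) by (rewrite cos_2PI3; lra).
  rewrite <- (cos_Rabs x). apply cos_decreasing_1; lra.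
Qed.

Lemma reduced_shift (j : Z) (rho : R) :
  - (2 * PI / 3) <= rho < 2 * PI ->
  reduced (IZR j * (8 * PI / 3) + rho) = rho.
Proof.
  intros Hrho. assert (HPI := PI_RGT_0). unfold reduced.
  rewrite (floor_unique _ j); [ring|].
  replace ((IZR j * (8 * PI / 3) + rho + 2 * PI / 3) / (8 * PI / 3))
    with (IZR j + (rho + 2 * PI / 3) / (8 * PI / 3)) by (field; lra).
  split.
  - assert (0 <= (rho + 2 * PI / 3) / (8 * PI / 3)); [|lra].
    apply Rdiv_le_0_compat; lra.
  - assert ((rho + 2 * PI / 3) / (8 * PI / 3) < 1); [|lra].
    apply Rlt_div_l; lra.
Qed.

(** At the border lines the sign of z is not determined by the sector, since
    such a line belongs to two of them; it is immaterial there because z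
    vanishes on these lines. *)
Lemma label_position (k : Z) (tau : R) : Rabs tau <= 2 * PI / 3 ->
  let t := IZR k * (4 * PI / 3) + tau in
  param t = parity k * tau /\
  (zsign t = - parity k \/ Rabs tau = 2 * PI / 3).
Proof.
  intros Htau t. assert (HPI := PI_RGT_0).
  assert (Htau' : - (2 * PI / 3) <= tau <= 2 * PI / 3)
    by (apply Rabs_le_between; exact Htau).
  unfold parity. destruct (Z.even k) eqn:Hk.
  - apply Z.even_spec in Hk. destruct Hk as [j ->].
    assert (Hr : reduced t = tau).
    { rewrite <- (reduced_shift j tau) by lra.
      unfold t. rewrite mult_IZR. f_equal. field. }
    unfold param, zsign. rewrite Hr.
    destruct (Rle_dec tau (2 * PI / 3)); [|lra].
    split; [ring|left; ring].
  - assert (Hodd : Z.odd k = true) by now rewrite <- Z.negb_even, Hk.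
    apply Z.odd_spec in Hodd. destruct Hodd as [j ->].
    destruct (Rlt_dec tau (2 * PI / 3)) as [Hlt|Hge].
    + assert (Hr : reduced t = 4 * PI / 3 + tau).
      { rewrite <- (reduced_shift j (4 * PI / 3 + tau)) by lra.
        unfold t. rewrite plus_IZR, mult_IZR. f_equal. field. }
      unfold param, zsign. rewrite Hr.
      destruct (Rle_dec (4 * PI / 3 + tau) (2 * PI / 3)).
      * (* tau = - 2 PI / 3, still reached from the previous sector *)
        split; [lra|right]. rewrite Rabs_left; lra.
      * split; [lra|left; ring].
    + (* the reduced label jumps by a whole period at this end *)
      assert (Htop : tau = 2 * PI / 3) by lra.
      assert (Hr : reduced t = - (2 * PI / 3)).
      { rewrite <- (reduced_shift (j + 1) (- (2 * PI / 3))) by lra.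
        unfold t. rewrite Htop, !plus_IZR, mult_IZR. f_equal. field. }
      unfold param. rewrite Hr.
      destruct (Rle_dec (- (2 * PI / 3)) (2 * PI / 3)); [|lra].
      split; [lra|right]. rewrite Rabs_pos_eq; lra.
Qed.

Lemma radical_end tau : Rabs tau = 2 * PI / 3 -> sqrt (1 + 2 * cos tau) = 0.
Proof.
  intros Htau.
  assert (Hc : cos tau = -1 / 2).
  { rewrite <- cos_2PI3, <- (cos_Rabs tau), Htau. f_equal. field. }
  rewrite Hc. replace (1 + 2 * (-1 / 2)) with 0 by field. apply sqrt_0.
Qed.

Definition sector (k : Z) (m tau : R) : R * R * R :=
  (parity k * omega1 m tau, omega2 m tau, - parity k * omega3 m tau).

Lemma sin_parity k x : sin (parity k * x) = parity k * sin x.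
Proof.
  unfold parity; destruct (Z.even k); rewrite ?Rmult_1_l; [reflexivity|].
  replace (-1 * x) with (- x) by ring. rewrite sin_neg. ring.
Qed.

Lemma cos_parity k x : cos (parity k * x) = cos x.
Proof.
  unfold parity; destruct (Z.even k); rewrite ?Rmult_1_l; [reflexivity|].
  replace (-1 * x) with (- x) by ring. apply cos_neg.
Qed.

Lemma surface_sector k m tau : Rabs tau <= 2 * PI / 3 ->
  surface m (IZR k * (4 * PI / 3) + tau) = sector k m tau.
Proof.
  intros Htau. destruct (label_position k tau Htau) as [Hp Hz].
  unfold surface, sector, omega1, omega2, omega3.
  rewrite Hp, sin_parity, cos_parity. f_equal; [f_equal; ring|].
  destruct Hz as [->|Hz]; [reflexivity|]. rewrite (radical_end _ Hz).
  unfold Rdiv. ring.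
Qed.

(** The parameter is found by comparing the x-coordinates,
    (1 - m) sin = (sin - tan) / 3. *)
Lemma edge_sector k tau : Rabs tau <= 2 * PI / 3 -> cos tau <> 0 ->
  edge (IZR k * (4 * PI / 3) + tau)
  = sector k ((1 + 2 * cos tau) / (3 * cos tau)) tau.
Proof.
  intros Htau Hc. destruct (label_position k tau Htau) as [Hp Hz].
  assert (Hb := cos_sector_ge tau Htau).
  assert (Hw : sqrt (1 + 2 * cos tau) ^ 3
               = (1 + 2 * cos tau) * sqrt (1 + 2 * cos tau)).
  { rewrite <- (sqrt_sqrt (1 + 2 * cos tau)) at 2 by lra. ring. }
  unfold edge, edge_point, sector, omega1, omega2, omega3, tan.
  rewrite Hp, sin_parity, cos_parity. f_equal; [f_equal|].
  - field. exact Hc.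
  - field. lra.
  - rewrite Hw. destruct Hz as [->|Hz].
    + field. lra.
    + rewrite (radical_end _ Hz). unfold Rdiv. ring.
Qed.

Lemma edge_defined_sector k tau : Rabs tau <= 2 * PI / 3 ->
  edge_defined (IZR k * (4 * PI / 3) + tau) <-> cos tau <> 0.
Proof.
  intros Htau. destruct (label_position k tau Htau) as [Hp _].
  unfold edge_defined. rewrite Hp. split.
  - intros [H1 H2] Hc. rewrite <- (cos_parity k) in Hc.
    assert (Hb : Rabs (parity k * tau) <= 2 * PI / 3).
    { rewrite Rabs_mult. unfold parity; destruct (Z.even k);
        rewrite ?Rabs_Ropp, ?Rabs_R1; [lra|]. rewrite Rabs_left; lra. }
    apply Rabs_le_between in Hb. assert (HPI := PI_RGT_0).
    destruct (cos_eq_0_0 _ Hc) as [n Hn].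
    rewrite Hn in Hb, H1, H2.
    assert (Hlo : -2 < IZR n) by nra. assert (Hhi : IZR n < 1) by nra.
    apply lt_IZR in Hlo, Hhi.
    assert (Hcase : n = (-1)%Z \/ n = 0%Z) by lia.
    destruct Hcase as [-> | ->]; [apply H2|apply H1]; field.
  - intros Hc. split; intros H; apply Hc; rewrite <- (cos_parity k), H.
    + apply cos_PI2.
    + rewrite cos_neg. apply cos_PI2.
Qed.

(** Ties in the rounding performed by [turns] are harmless: every later fact
    about a sector holds on the closed sector, so any k with
    |t - k (4 PI / 3)| <= 2 PI / 3 serves as well. *)
Lemma turns_spec t : exists k : Z, turns t = IZR k /\ Rabs (h t) <= 2 * PI / 3.
Proof.
  assert (HPI := PI_RGT_0).
  unfold h, turns. set (n := floor _).
  assert (Hn : IZR n <= 3 * Rabs t / (4 * PI) + 1 / 2 < IZR n + 1)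
    by (unfold n, floor; now destruct floor_ex).
  assert (Ht : Rabs (Rabs t - IZR n * (4 * PI / 3)) <= 2 * PI / 3).
  { replace (Rabs t) with (3 * Rabs t / (4 * PI) * (4 * PI / 3))
      by (field; lra).
    set (q := 3 * Rabs t / (4 * PI)) in *. apply Rabs_le. nra. }
  destruct (Rtotal_order t 0) as [Hneg|[->|Hpos]].
  - exists (- n)%Z. rewrite (sign_eq_m1 _ Hneg), opp_IZR. split; [ring|].
    rewrite (Rabs_left t Hneg) in Ht. rewrite <- Rabs_Ropp.
    eapply Rle_trans; [|exact Ht]. right. f_equal. ring.
  - exists 0%Z. rewrite sign_0. split; [ring|].
    rewrite Rabs_R0 in *. rewrite Rmult_0_l, Rmult_0_l, Rminus_0_r, Rabs_R0.
    lra.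
  - exists n. rewrite (sign_eq_1 _ Hpos). split; [ring|].
    rewrite (Rabs_pos_eq t) in Ht by lra. now rewrite Rmult_1_l.
Qed.

Lemma label_exists t :
  exists k, turns t = IZR k /\ t = IZR k * (4 * PI / 3) + h t /\
    Rabs (h t) <= 2 * PI / 3.
Proof.
  destruct (turns_spec t) as [k [Hk Hh]]. exists k.
  split; [exact Hk|]. split; [|exact Hh].
  rewrite <- Hk. unfold h. ring.
Qed.

Lemma label_glue k :
  IZR (Z.succ k) * (4 * PI / 3) + - (2 * PI / 3)
  = IZR k * (4 * PI / 3) + 2 * PI / 3.
Proof. rewrite succ_IZR. field. Qed.

(** The scheme by which all facts about the labels are propagated from the
    initial line: along a closed sector, then over the border line that it
    shares with the next or the previous sector. *)
Lemma continuation (Q : Z -> R -> Prop) :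
  Q 0%Z 0 ->
  (forall k tau tau', Rabs tau <= 2 * PI / 3 -> Rabs tau' <= 2 * PI / 3 ->
    Q k tau -> Q k tau') ->
  (forall k, Q k (2 * PI / 3) <-> Q (Z.succ k) (- (2 * PI / 3))) ->
  forall k tau, Rabs tau <= 2 * PI / 3 -> Q k tau.
Proof.
  intros H0 Hloc Hglue. assert (HPI := PI_RGT_0).
  assert (Hz : Rabs 0 <= 2 * PI / 3) by (rewrite Rabs_R0; lra).
  assert (Hr : Rabs (2 * PI / 3) <= 2 * PI / 3)
    by (rewrite Rabs_pos_eq; lra).
  assert (Hl : Rabs (- (2 * PI / 3)) <= 2 * PI / 3)
    by now rewrite Rabs_Ropp.
  enough (H : forall k, Q k 0) by (intros k tau Htau; apply (Hloc k 0); auto).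
  apply Z.bi_induction; [now intros i j ->|exact H0|].
  intros k; split; intros Hk.
  - apply (Hloc _ (- (2 * PI / 3))); auto. apply Hglue. now apply (Hloc k 0).
  - apply (Hloc _ (2 * PI / 3)); auto. apply Hglue. now apply (Hloc _ 0).
Qed.

(** * First fundamental form and unit normal *)

(** The partial derivatives of the surface with respect to m and to t. *)
Definition sector_ruling (k : Z) (tau : R) : R * R * R :=
  let c := cos tau in
  (- parity k * sin tau, (1 + c + c ^ 2) / (1 + c),
   - parity k * (sqrt (1 + 2 * c) / (1 + c))).

Definition sector_velocity (k : Z) (m tau : R) : R * R * R :=
  let c := cos tau in let s := sin tau in
  (parity k * (1 - m) * c, (1 - m) * s + m * (s / (1 + c) ^ 2),
   - parity k * m * (s * c / (sqrt (1 + 2 * c) * (1 + c) ^ 2))).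

(** The cross product of the two partial derivatives, freed from its common
    factor.  In this form it extends continuously to the border lines, where
    the surface has no derivative in t. *)
Definition sector_normal (k : Z) (tau : R) : R * R * R :=
  let c := cos tau in let a := / (sqrt 2 * sqrt (1 + c)) in
  (parity k * sin tau * a, - c * a, - parity k * sqrt (1 + 2 * c) * a).

(** The relations between the radicals, the sine and the cosine that turn the
    identities below into polynomial ones.  A lower bound on [cos x] has to be
    in the context. *)
Ltac pose_radicals x :=
  assert (Hr : 0 < sqrt (1 + cos x)) by (apply sqrt_lt_R0; lra);
  assert (Hr2 : sqrt (1 + cos x) ^ 2 = 1 + cos x) by (apply pow2_sqrt; lra);
  assert (Hw2 : sqrt (1 + 2 * cos x) ^ 2 = 1 + 2 * cos x)
    by (apply pow2_sqrt; lra);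
  assert (Hs2 : sin x ^ 2 = 1 - cos x ^ 2)
    by (rewrite <- !Rsqr_pow2; apply sin2);
  assert (H2p : 0 < sqrt 2) by (apply sqrt_lt_R0; lra);
  assert (H2 : sqrt 2 ^ 2 = 2) by (apply pow2_sqrt; lra);
  assert (H3p : 0 < sqrt 3) by (apply sqrt_lt_R0; lra);
  assert (H3 : sqrt 3 ^ 2 = 3) by (apply pow2_sqrt; lra).

Lemma is_derive_surface_ruling k m tau : Rabs tau <= 2 * PI / 3 ->
  is_derive (fun m' => surface m' (IZR k * (4 * PI / 3) + tau)) m
    (sector_ruling k tau).
Proof.
  intros Htau. assert (Hc := cos_sector_ge tau Htau).
  apply is_derive_ext with (fun m' => sector k m' tau).
  { intros m'. symmetry. now apply surface_sector. }
  unfold sector, sector_ruling, omega1, omega2, omega3.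
  apply (is_derive_pair (V := prod_NormedModule _ _ _));
    [apply is_derive_pair|]; auto_derive; trivial; field; lra.
Qed.

Lemma locally_sector k (P : R -> Prop) tau : Rabs tau < 2 * PI / 3 ->
  (forall x, Rabs x < 2 * PI / 3 -> P (IZR k * (4 * PI / 3) + x)) ->
  locally (IZR k * (4 * PI / 3) + tau) P.
Proof.
  intros Htau HP.
  assert (He : 0 < 2 * PI / 3 - Rabs tau) by lra.
  exists (mkposreal _ He). intros y Hy.
  change (Rabs (y - (IZR k * (4 * PI / 3) + tau)) < 2 * PI / 3 - Rabs tau)
    in Hy.
  replace y with (IZR k * (4 * PI / 3) + (y - IZR k * (4 * PI / 3))) by ring.
  apply HP.
  replace (y - IZR k * (4 * PI / 3))
    with ((y - (IZR k * (4 * PI / 3) + tau)) + tau) by ring.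
  eapply Rle_lt_trans; [apply Rabs_triang|lra].
Qed.

Lemma is_derive_surface_label k m tau : Rabs tau < 2 * PI / 3 ->
  is_derive (fun t => surface m t) (IZR k * (4 * PI / 3) + tau)
    (sector_velocity k m tau).
Proof.
  intros Htau. assert (Hc := cos_sector_gt tau Htau).
  apply is_derive_ext_loc
    with (fun t => sector k m (t - IZR k * (4 * PI / 3))).
  { apply locally_sector; [exact Htau|]. intros x Hx.
    rewrite surface_sector by lra. f_equal. ring. }
  assert (Hw : 0 < sqrt (1 + 2 * cos tau)) by (apply sqrt_lt_R0; lra).
  pose_radicals tau.
  assert (Harg : IZR k * (4 * PI / 3) + tau + - (IZR k * (4 * PI / 3)) = tau)
    by ring.
  unfold sector, sector_velocity, omega1, omega2, omega3.
  apply (is_derive_pair (V := prod_NormedModule _ _ _));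
    [apply is_derive_pair|]; auto_derive; rewrite ?Harg; trivial.
  - ring.
  - lra.
  - field; lra.
  - split; lra.
  - field_simplify_eq; [|lra]. ring [Hw2].
Qed.

Lemma sector_dot k m tau : Rabs tau < 2 * PI / 3 ->
  dot3 (sector_ruling k tau) (sector_velocity k m tau)
  = sin tau / (1 + cos tau).
Proof.
  intros Htau. assert (Hc := cos_sector_gt tau Htau).
  assert (Hw : 0 < sqrt (1 + 2 * cos tau)) by (apply sqrt_lt_R0; lra).
  assert (Hk : parity k ^ 2 = 1) by (rewrite <- (parity_sqr k); ring).
  unfold dot3, sector_ruling, sector_velocity.
  field_simplify_eq; [|lra]. ring [Hk].
Qed.

Lemma scal_triple (l x y z : R) :
  scal l ((x, y, z) : R * R * R) = (l * x, l * y, l * z).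
Proof. reflexivity. Qed.

(** The direction of the cross product does not depend on m: the surface is
    developable.  Its length vanishes for m = (1 + 2 c) / (3 c), which is the
    point of the edge of regression. *)
Lemma sector_cross k m tau : Rabs tau < 2 * PI / 3 ->
  let c := cos tau in
  cross (sector_ruling k tau) (sector_velocity k m tau)
  = scal (sqrt 2 * sqrt (1 + 2 * c) / sqrt (1 + c)
            * (1 - 3 * c * m / (1 + 2 * c)))
      (sector_normal k tau).
Proof.
  intros Htau c. subst c. assert (Hc := cos_sector_gt tau Htau).
  assert (Hw : 0 < sqrt (1 + 2 * cos tau)) by (apply sqrt_lt_R0; lra).
  pose_radicals tau.
  assert (Hk : parity k ^ 2 = 1) by (rewrite <- (parity_sqr k); ring).
  unfold cross, sector_ruling, sector_velocity, sector_normal.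
  cbv zeta.
  rewrite scal_triple.
  f_equal; [f_equal|].
  - field_simplify_eq; [|repeat split; lra]. ring [Hw2 Hr2 Hs2 Hk].
  - field_simplify_eq; [|repeat split; lra]. ring [Hw2 Hr2 Hs2 Hk].
  - field_simplify_eq; [|repeat split; lra]. ring [Hw2 Hr2 Hs2 Hk].
Qed.

Lemma sector_normal_unit k tau : Rabs tau <= 2 * PI / 3 ->
  dot3 (sector_normal k tau) (sector_normal k tau) = 1.
Proof.
  intros Htau. assert (Hc := cos_sector_ge tau Htau).
  pose_radicals tau.
  assert (Hk : parity k ^ 2 = 1) by (rewrite <- (parity_sqr k); ring).
  unfold dot3, sector_normal.
  field_simplify_eq; [|lra]. ring [Hw2 Hr2 Hs2 Hk H2].
Qed.

Lemma sector_normal_glue k :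
  sector_normal k (2 * PI / 3) = sector_normal (Z.succ k) (- (2 * PI / 3)).
Proof.
  assert (HPI := PI_RGT_0).
  unfold sector_normal. rewrite parity_succ, cos_neg, sin_neg.
  rewrite radical_end by (rewrite Rabs_pos_eq; lra).
  f_equal; [f_equal|]; ring.
Qed.

(** If n is a unit vector orthogonal to x and y, then it is parallel to their
    cross product, so equality holds in the Cauchy-Schwarz inequality. *)
Lemma dot3_cross_sqr (n x y : R * R * R) :
  dot3 n n = 1 -> dot3 n x = 0 -> dot3 n y = 0 ->
  dot3 n (cross x y) ^ 2 = dot3 (cross x y) (cross x y).
Proof.
  intros Hn Hx Hy.
  assert (H : dot3 n (cross x y) ^ 2
    = dot3 n n * dot3 (cross x y) (cross x y)
      - (dot3 n y ^ 2 * dot3 x x - 2 * dot3 n x * dot3 n y * dot3 x y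
         + dot3 n x ^ 2 * dot3 y y)).
  { destruct n as [[n1 n2] n3], x as [[x1 x2] x3], y as [[y1 y2] y3].
    unfold dot3, cross. ring. }
  rewrite H, Hn, Hx, Hy. ring.
Qed.

Lemma dot3_scal_r (l : R) (x y : R * R * R) :
  dot3 x (scal l y) = l * dot3 x y.
Proof.
  destruct x as [[x1 x2] x3], y as [[y1 y2] y3]. rewrite scal_triple.
  unfold dot3. ring.
Qed.

Lemma dot3_scal_l (l : R) (x y : R * R * R) :
  dot3 (scal l x) y = l * dot3 x y.
Proof.
  destruct x as [[x1 x2] x3], y as [[y1 y2] y3]. rewrite scal_triple.
  unfold dot3. ring.
Qed.

Lemma normal_dot_sqr N k tau : unit_normal_field N -> Rabs tau < 2 * PI / 3 ->
  let f := dot3 (N (IZR k * (4 * PI / 3) + tau)) (sector_normal k tau) in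
  f * f = 1.
Proof.
  intros HN Htau f. assert (Hc := cos_sector_gt tau Htau).
  assert (Hw : 0 < sqrt (1 + 2 * cos tau)) by (apply sqrt_lt_R0; lra).
  pose_radicals tau.
  assert (H := dot3_cross_sqr (N (IZR k * (4 * PI / 3) + tau))
    (sector_ruling k tau) (sector_velocity k 0 tau)
    (normal_unit _ HN _)
    (normal_along _ HN 0 _ _
       (is_derive_surface_ruling k 0 tau (Rlt_le _ _ Htau)))
    (normal_across _ HN 0 _ _ (is_derive_surface_label k 0 tau Htau))).
  rewrite sector_cross in H by exact Htau.
  rewrite !dot3_scal_r, dot3_scal_l, sector_normal_unit in H by lra.
  fold f in H. revert H.
  set (l := sqrt 2 * _ / _ * _). intros H.
  assert (Hl : l <> 0).
  { unfold l. replace (1 - 3 * cos tau * 0 / (1 + 2 * cos tau)) with 1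
      by (field; lra).
    apply Rgt_not_eq. rewrite Rmult_1_r.
    apply Rdiv_lt_0_compat; [|exact Hr]. now apply Rmult_lt_0_compat. }
  apply (Rmult_eq_reg_l (l * l)).
  - rewrite Rmult_1_r in H |- *. nra.
  - intros H0. apply Rmult_integral in H0. tauto.
Qed.

Lemma continuous_cos x : continuous cos x.
Proof. apply continuity_pt_filterlim, continuity_cos. Qed.

Lemma continuous_sin x : continuous sin x.
Proof. apply continuity_pt_filterlim, continuity_sin. Qed.

Lemma continuous_radical x : continuous (fun y => sqrt (1 + 2 * cos y)) x.
Proof.
  apply (continuous_comp (fun y => 1 + 2 * cos y) sqrt).
  - apply (continuous_plus (fun _ => 1) (fun y => 2 * cos y));
      [apply continuous_const|].
    apply (continuous_mult (fun _ => 2) cos);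
      [apply continuous_const|apply continuous_cos].
  - apply continuous_sqrt.
Qed.

Lemma continuous_Rplus (f g : R -> R) x :
  continuous f x -> continuous g x -> continuous (fun y => f y + g y) x.
Proof. apply (continuous_plus f g). Qed.

Lemma continuous_Rmult (f g : R -> R) x :
  continuous f x -> continuous g x -> continuous (fun y => f y * g y) x.
Proof. apply (continuous_mult f g). Qed.

Lemma continuous_Ropp (f : R -> R) x :
  continuous f x -> continuous (fun y => - f y) x.
Proof. apply (continuous_opp f). Qed.

Ltac prove_continuous :=
  repeat match goal with
  | |- continuous (fun x => @?f x + @?g x) _ => apply (continuous_Rplus f g)
  | |- continuous (fun x => @?f x * @?g x) _ => apply (continuous_Rmult f g)
  | |- continuous (fun x => - @?f x) _ => apply (continuous_Ropp f)
  | |- continuous (fun x => cos x) _ => apply continuous_cos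
  | |- continuous (fun x => sin x) _ => apply continuous_sin
  | |- continuous (fun x => sqrt (1 + 2 * cos x)) _ => apply continuous_radical
  | |- continuous (fun _ => ?a) _ => apply (continuous_const a)
  | |- continuous _ _ => assumption
  end.

Lemma continuous_normal_dot N k tau : unit_normal_field N ->
  Rabs tau <= 2 * PI / 3 ->
  continuous (fun x => dot3 (N (IZR k * (4 * PI / 3) + x)) (sector_normal k x))
    tau.
Proof.
  intros HN Htau. assert (Hc := cos_sector_ge tau Htau).
  pose_radicals tau.
  assert (HNc : continuous (fun x => N (IZR k * (4 * PI / 3) + x)) tau).
  { apply (continuous_comp (fun x => IZR k * (4 * PI / 3) + x) N).
    - apply (continuous_plus (fun _ => IZR k * (4 * PI / 3)) (fun x => x));
        [apply continuous_const|apply continuous_id].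
    - apply (normal_continuous _ HN). }
  assert (Ha : continuous (fun x => / (sqrt 2 * sqrt (1 + cos x))) tau).
  { apply (ex_derive_continuous (V := R_NormedModule)). auto_derive.
    split; [lra|]. split; [|trivial].
    apply Rgt_not_eq, Rmult_lt_0_compat; lra. }
  apply (continuous_ext (fun x =>
    fst (fst (N (IZR k * (4 * PI / 3) + x)))
      * (parity k * sin x * / (sqrt 2 * sqrt (1 + cos x)))
    + snd (fst (N (IZR k * (4 * PI / 3) + x)))
      * (- cos x * / (sqrt 2 * sqrt (1 + cos x)))
    + snd (N (IZR k * (4 * PI / 3) + x))
      * (- parity k * sqrt (1 + 2 * cos x) * / (sqrt 2 * sqrt (1 + cos x))))).
  { intros x. now destruct (N _) as [[n1 n2] n3]. }
  prove_continuous.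
  - now apply continuous_fst_comp, continuous_fst_comp.
  - now apply continuous_snd_comp, continuous_fst_comp.
  - now apply continuous_snd_comp.
Qed.

(** N is one of the two unit normals at each label, and by continuity it is
    always on the same side of the explicit one. *)
Lemma normal_orientation N : unit_normal_field N ->
  forall k tau, Rabs tau <= 2 * PI / 3 ->
  dot3 (N (IZR k * (4 * PI / 3) + tau)) (sector_normal k tau)
  = dot3 (N 0) (sector_normal 0 0).
Proof.
  intros HN. assert (HPI := PI_RGT_0).
  apply (continuation (fun k tau =>
    dot3 (N (IZR k * (4 * PI / 3) + tau)) (sector_normal k tau)
    = dot3 (N 0) (sector_normal 0 0))).
  - now rewrite Rmult_0_l, Rplus_0_l.
  - intros k tau tau' Htau Htau' H. rewrite <- H.
    apply Rabs_le_between in Htau, Htau'.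
    apply (continuous_sign_constant
      (fun x => dot3 (N (IZR k * (4 * PI / 3) + x)) (sector_normal k x))
      (- (2 * PI / 3)) (2 * PI / 3)); try lra.
    + intros x Hx. apply normal_dot_sqr; [exact HN|now apply Rabs_lt_between].
    + intros x Hx. apply continuous_normal_dot; [exact HN|].
      now apply Rabs_le_between.
  - intros k. rewrite sector_normal_glue, label_glue. reflexivity.
Qed.

(** * Differential equations of a development *)

Lemma norm_pair_sqr (v : R * R) : norm v ^ 2 = dot2 v v.
Proof.
  destruct v as [x y]. unfold dot2; simpl fst; simpl snd.
  change (norm (x, y)) with (sqrt (Rabs x ^ 2 + Rabs y ^ 2)).
  rewrite pow2_sqrt, !pow2_abs; [ring|].
  rewrite !pow2_abs. nra.
Qed.

Lemma norm_triple_sqr (v : R * R * R) : norm v ^ 2 = dot3 v v.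
Proof.
  destruct v as [[x y] z]. unfold dot3.
  change (norm (x, y, z))
    with (sqrt (sqrt (Rabs x ^ 2 + Rabs y ^ 2) ^ 2 + Rabs z ^ 2)).
  assert (H : 0 <= Rabs x ^ 2 + Rabs y ^ 2) by (rewrite !pow2_abs; nra).
  rewrite (pow2_sqrt _ H), pow2_sqrt, !pow2_abs; [ring|].
  rewrite !pow2_abs. nra.
Qed.

Lemma sector_affine k m tau : - (1 / 2) <= cos tau ->
  sector k m tau = plus (sector k 0 tau) (scal m (sector_ruling k tau)).
Proof.
  intros Hc.
  unfold sector, sector_ruling, omega1, omega2, omega3. rewrite scal_triple.
  change (plus (?a, ?b, ?c) (?x, ?y, ?z)) with (a + x, b + y, c + z).
  f_equal; [f_equal|]; field; lra.
Qed.

Lemma sector_ruling_sqr k tau : - (1 / 2) <= cos tau ->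
  dot3 (sector_ruling k tau) (sector_ruling k tau) = 3.
Proof.
  intros Hc.
  pose_radicals tau.
  assert (Hk : parity k ^ 2 = 1) by (rewrite <- (parity_sqr k); ring).
  unfold dot3, sector_ruling.
  field_simplify_eq; [|lra]. ring [Hw2 Hs2 Hk].
Qed.

Definition dev_ruling (D : R -> R -> R * R) (t : R) : R * R :=
  minus (D 1 t) (D 0 t).

(** The end points of the ruling segment are at distance sqrt 3 on every
    generating line of the oloid. *)
Lemma dev_distance e_xi e_eta N D (HD : is_development e_xi e_eta N D) m m' t :
  let v := minus (D m t) (D m' t) in dot2 v v = 3 * (m - m') ^ 2.
Proof.
  intros v. unfold v. rewrite <- norm_pair_sqr, (dev_line _ _ _ _ HD).
  rewrite norm_triple_sqr.
  destruct (label_exists t) as [k [_ [Ht Hh]]].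
  rewrite Ht, !surface_sector by exact Hh.
  assert (Hc := cos_sector_ge _ Hh).
  rewrite (sector_affine k m), (sector_affine k m') by exact Hc.
  replace (minus _ _) with (scal (m - m') (sector_ruling k (h t))).
  - rewrite dot3_scal_r, dot3_scal_l, sector_ruling_sqr by exact Hc. ring.
  - destruct (sector k 0 (h t)) as [[a b] c].
    destruct (sector_ruling k (h t)) as [[x y] z]. rewrite !scal_triple.
    change (minus (plus (?a, ?b, ?c) (?x, ?y, ?z))
              (plus (?a, ?b, ?c) (?u, ?v, ?w)))
      with (a + x + - (a + u), b + y + - (b + v), c + z + - (c + w)).
    f_equal; [f_equal|]; ring.
Qed.

Lemma dev_ruling_sqr e_xi e_eta N D (HD : is_development e_xi e_eta N D) t :
  dot2 (dev_ruling D t) (dev_ruling D t) = 3.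
Proof.
  unfold dev_ruling. rewrite (dev_distance _ _ _ _ HD). ring.
Qed.

(** A map from a line to the Euclidean plane that preserves distances is
    affine: the three distances between D(0), D(1), D(m) force these points to
    be collinear.  The quantity shown to vanish is the squared distance from
    D(m) to the expected point, a combination of these three distances. *)
Lemma dev_affine e_xi e_eta N D (HD : is_development e_xi e_eta N D) m t :
  D m t = plus (D 0 t) (scal m (dev_ruling D t)).
Proof.
  assert (H10 := dev_distance _ _ _ _ HD 1 0 t).
  assert (Hm0 := dev_distance _ _ _ _ HD m 0 t).
  assert (Hm1 := dev_distance _ _ _ _ HD m 1 t).
  revert H10 Hm0 Hm1. unfold dev_ruling.
  destruct (D m t) as [x y], (D 1 t) as [x1 y1], (D 0 t) as [x0 y0].
  change (minus (?a, ?b) (?u, ?v)) with (a - u, b - v).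
  change (plus (x0, y0) (scal m (?u, ?v))) with (x0 + m * u, y0 + m * v).
  unfold dot2; simpl. intros H10 Hm0 Hm1.
  assert (H : (x - (x0 + m * (x1 - x0))) ^ 2
            + (y - (y0 + m * (y1 - y0))) ^ 2 = 0).
  { transitivity ((1 - m) * ((x - x0) * (x - x0) + (y - y0) * (y - y0))
      + (m ^ 2 - m) * ((x1 - x0) * (x1 - x0) + (y1 - y0) * (y1 - y0))
      + m * ((x - x1) * (x - x1) + (y - y1) * (y - y1))); [ring|].
    rewrite H10, Hm0, Hm1. ring. }
  assert (Hx := pow2_ge_0 (x - (x0 + m * (x1 - x0)))).
  assert (Hy := pow2_ge_0 (y - (y0 + m * (y1 - y0)))).
  f_equal; apply Rminus_diag_uniq, Rsqr_eq_0; unfold Rsqr; nra.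
Qed.

Definition perp (v : R * R) : R * R := (- snd v, fst v).

Lemma vector_from_products (v w : R * R) : dot2 v v = 3 ->
  w = plus (scal (dot2 v w / 3) v) (scal (det2 v w / 3) (perp v)).
Proof.
  destruct v as [v1 v2], w as [w1 w2]. unfold dot2, det2, perp. simpl.
  intros H.
  change (plus (scal ?a (?x, ?y)) (scal ?b (?u, ?v)))
    with (a * x + b * u, a * y + b * v).
  f_equal.
  - transitivity ((v1 * v1 + v2 * v2) / 3 * w1); [rewrite H; field|field].
  - transitivity ((v1 * v1 + v2 * v2) / 3 * w2); [rewrite H; field|field].
Qed.

(** Isometry prescribes the scalar product and the determinant of the
    t-derivative with the developed ruling, hence this derivative.  The
    orientation sign sigma is kept as a parameter because its value is obtained
    from this very equation at t = 0. *)
Lemma is_derive_development e_xi e_eta N D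
    (HD : is_development e_xi e_eta N D) k m tau sigma :
  Rabs tau < 2 * PI / 3 ->
  let c := cos tau in
  let t := IZR k * (4 * PI / 3) + tau in
  dot3 (N t) (sector_normal k tau) = sigma ->
  is_derive (fun t => D m t) t
    (plus
       (scal (sin tau / (1 + c) / 3) (dev_ruling D t))
       (scal (sigma * (sqrt 2 * sqrt (1 + 2 * c) / sqrt (1 + c)
                         * (1 - 3 * c * m / (1 + 2 * c))) / 3)
          (perp (dev_ruling D t)))).
Proof.
  intros Htau c t Hsigma.
  destruct (dev_isometric _ _ _ _ HD m t _ _
    (is_derive_surface_ruling k m tau (Rlt_le _ _ Htau))
    (is_derive_surface_label k m tau Htau))
    as [Dm [Dt [HDm [HDt [_ [Hdot [_ Hdet]]]]]]].
  (* The derivative along the line is the ruling, as D is affine there. *)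
  assert (HV : Dm = dev_ruling D t).
  { assert (Haff : is_derive (fun m' => D m' t) m (dev_ruling D t)).
    { apply is_derive_ext with
        (fun m' => plus (D 0 t) (scal m' (dev_ruling D t))).
      { intros m'. symmetry. apply (dev_affine _ _ _ _ HD). }
      destruct (D 0 t) as [x y], (dev_ruling D t) as [u v].
      apply (is_derive_pair (fun m' => x + m' * u) (fun m' => y + m' * v));
        auto_derive; trivial; ring. }
    destruct Dm as [d1 d2]. rewrite (surjective_pairing (dev_ruling D t)).
    f_equal.
    - transitivity (Derive (fun m' => fst (D m' t)) m).
      + symmetry. apply is_derive_unique, (is_derive_fst _ _ _ HDm).
      + apply is_derive_unique, (is_derive_fst _ _ _ Haff).
    - transitivity (Derive (fun m' => snd (D m' t)) m).
      + symmetry. apply is_derive_unique, (is_derive_snd _ _ _ HDm).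
      + apply is_derive_unique, (is_derive_snd _ _ _ Haff). }
  subst Dm. rewrite sector_dot in Hdot by exact Htau.
  assert (Hdet' : det3 (sector_ruling k tau) (sector_velocity k m tau) (N t)
    = sigma * (sqrt 2 * sqrt (1 + 2 * c) / sqrt (1 + c)
                 * (1 - 3 * c * m / (1 + 2 * c)))).
  { unfold det3. rewrite sector_cross by exact Htau.
    rewrite dot3_scal_l, <- Hsigma. fold c. rewrite Rmult_comm. f_equal.
    destruct (N t) as [[a1 a2] a3], (sector_normal k tau) as [[b1 b2] b3].
    unfold dot3. ring. }
  rewrite Hdet' in Hdet.
  rewrite (vector_from_products _ Dt (dev_ruling_sqr _ _ _ _ HD t)), Hdot, Hdet
    in HDt.
  exact HDt.
Qed.

Lemma dot3_comm (x y : R * R * R) : dot3 x y = dot3 y x.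
Proof. destruct x as [[x1 x2] x3], y as [[y1 y2] y3]. unfold dot3. ring. Qed.

Lemma dot3_plus_r (x y z : R * R * R) :
  dot3 x (plus y z) = dot3 x y + dot3 x z.
Proof.
  destruct x as [[x1 x2] x3], y as [[y1 y2] y3], z as [[z1 z2] z3].
  change (plus (y1, y2, y3) (z1, z2, z3)) with (y1 + z1, y2 + z2, y3 + z3).
  unfold dot3. ring.
Qed.

(** The frame is attached to the initial line, on which D is the identity. *)
Lemma dev_initial e_xi e_eta N D (Hf : plane_frame e_xi e_eta (N 0))
    (HD : is_development e_xi e_eta N D) m :
  D m 0 = (0, sqrt 3 * m).
Proof.
  destruct (frame_axis _ _ _ Hf) as [l [Hl Haxis]].
  assert (Hxi := frame_xi _ _ _ Hf). assert (Heta := frame_eta _ _ _ Hf).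
  assert (Horth := frame_orth _ _ _ Hf).
  assert (Hfix : forall m, minus (surface m 0) (surface 0 0)
    = plus (scal (fst (D m 0)) e_xi) (scal (snd (D m 0)) e_eta)).
  { intros m'. rewrite (dev_fixed _ _ _ _ HD m') at 1.
    unfold minus. rewrite plus_comm, plus_assoc, plus_opp_l.
    apply plus_zero_l. }
  assert (Hcoord : forall m, D m 0 = (0, l * m)).
  { intros m'. specialize (Hfix m'). rewrite (Haxis m') in Hfix.
    destruct (D m' 0) as [x y]. simpl in Hfix.
    assert (H1 := f_equal (dot3 e_xi) Hfix).
    assert (H2 := f_equal (dot3 e_eta) Hfix).
    rewrite dot3_plus_r, !dot3_scal_r, Hxi, Horth in H1.
    rewrite dot3_plus_r, !dot3_scal_r, Heta, (dot3_comm e_eta), Horth in H2.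
    f_equal; lra. }
  assert (Hl3 : l ^ 2 = 3).
  { assert (H := dev_distance _ _ _ _ HD 1 0 0). simpl in H.
    rewrite !Hcoord in H.
    change (minus (0, ?x) (0, ?y)) with (0 - 0, x - y) in H.
    unfold dot2 in H; simpl in H. nra. }
  rewrite Hcoord, <- Hl3, sqrt_pow2 by lra. reflexivity.
Qed.

(** With the opposite sign the first coordinate of the developed circle would
    have a negative derivative at 0, and the lines for small positive t would
    be developed to the side xi < 0. *)
Lemma initial_orientation e_xi e_eta N D (HN : unit_normal_field N)
    (Hf : plane_frame e_xi e_eta (N 0)) (HD : is_development e_xi e_eta N D) :
  dot3 (N 0) (sector_normal 0 0) = -1.
Proof.
  assert (HPI := PI_RGT_0).
  assert (H0 : Rabs 0 < 2 * PI / 3) by (rewrite Rabs_R0; lra).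
  assert (Hz : IZR 0 * (4 * PI / 3) + 0 = 0) by ring.
  assert (Hsq := normal_dot_sqr N 0 0 HN H0). cbv zeta in Hsq.
  assert (Hd := is_derive_development _ _ _ _ HD 0 0 0 _ H0 eq_refl).
  cbv zeta in Hd. rewrite Hz in Hsq, Hd.
  set (sigma := dot3 (N 0) (sector_normal 0 0)) in *.
  enough (Hle : ~ 0 < sigma) by nra.
  intros Hpos.
  apply is_derive_fst in Hd.
  unfold dev_ruling in Hd. rewrite !(dev_initial _ _ _ _ Hf HD) in Hd.
  change (minus (0, ?x) (0, ?y)) with (0 - 0, x - y) in Hd.
  unfold perp in Hd.
  change (plus (scal ?a (?x, ?y)) (scal ?b (?u, ?v)))
    with (a * x + b * u, a * y + b * v) in Hd.
  simpl fst in Hd. simpl snd in Hd.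
  rewrite cos_0, sin_0 in Hd.
  destruct (dev_side _ _ _ _ HD) as [d [Hd0 Hside]].
  set (l := _ + _ : R) in Hd.
  assert (Hl : l < 0).
  { unfold l. assert (0 < sqrt 3) by (apply sqrt_lt_R0; lra).
    assert (Hq : 0 < sqrt 2 * sqrt (1 + 2 * 1) / sqrt (1 + 1)).
    { apply Rdiv_lt_0_compat; [apply Rmult_lt_0_compat|];
        apply sqrt_lt_R0; lra. }
    assert (Hqs := Rmult_lt_0_compat _ _ Hpos Hq).
    assert (Hqss := Rmult_lt_0_compat _ _ Hqs H).
    unfold Rdiv in *. rewrite !Rmult_0_r, Rmult_0_l. lra. }
  apply is_derive_Reals in Hd. destruct (Hd (- l)) as [del Hdel]; [lra|].
  assert (Hdel0 := cond_pos del).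
  set (x := Rmin (d / 2) (del / 2)).
  assert (Hx : 0 < x < d /\ x < del)
    by (unfold x, Rmin; destruct (Rle_dec (d / 2) (del / 2)); lra).
  assert (Hneg : fst (D 0 x) < 0).
  { specialize (Hdel x ltac:(lra)). rewrite Rabs_pos_eq in Hdel by lra.
    specialize (Hdel (proj2 Hx)). rewrite Rplus_0_l in Hdel.
    rewrite (dev_initial _ _ _ _ Hf HD) in Hdel. simpl fst in Hdel.
    apply Rabs_def2 in Hdel.
    replace (fst (D 0 x)) with ((fst (D 0 x) - 0) / x * x) by (field; lra).
    assert ((fst (D 0 x) - 0) / x < 0) by lra. nra. }
  assert (Hp := Hside 0 x). rewrite Rabs_R0 in Hp.
  specialize (Hp Hd0 (proj1 Hx)). lra.
Qed.

Lemma oriented_normal e_xi e_eta N D (HN : unit_normal_field N)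
    (Hf : plane_frame e_xi e_eta (N 0)) (HD : is_development e_xi e_eta N D)
    k tau :
  Rabs tau <= 2 * PI / 3 ->
  dot3 (N (IZR k * (4 * PI / 3) + tau)) (sector_normal k tau) = -1.
Proof.
  intros Htau. rewrite (normal_orientation N HN) by exact Htau.
  apply (initial_orientation _ _ _ _ HN Hf HD).
Qed.

(** * An explicit solution *)

(** The developed ruling, the same in all sectors.  Its angle phi with the eta-axis satisfies
    phi' = - sqrt 2 c / (sqrt (1 + 2 c) sqrt (1 + c)), with the primitive
    phi = 2 (alpha - 2 beta), cos alpha = sqrt 2 c / sqrt (1 + c),
    sin beta = 2 sin (tau / 2) / sqrt 3.  Expanding the sine and the cosine of
    phi leaves algebraic functions of c and s. *)
Definition dev_direction (tau : R) : R * R :=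
  let c := cos tau in
  (- (2 * sqrt 2 * sqrt 3 * (2 + c) * sqrt (1 + 2 * c) * sin tau
        / (9 * (1 + c) * sqrt (1 + c))),
   sqrt 3 * (7 + 7 * c + 4 * c ^ 2) / (9 * (1 + c))).

(** The development of the circle k_A for k = 0; eps is the sign of tau.  It
    is the candidate curve for the edge, minus (1 + 2 c) / (3 c) times
    [dev_direction]; the poles at c = 0 cancel. *)
Definition dev_circle (eps tau : R) : R * R :=
  let c := cos tau in
  (2 * sqrt 3 / 9 * (eps * acos (sqrt 2 * c / sqrt (1 + c))
     + sqrt 2 * sqrt (1 + 2 * c) * sin tau / sqrt (1 + c)),
   sqrt 3 / 9 * (ln (2 / (1 + c)) + 4 * (1 - c))).

Lemma dev_direction_sqr tau : Rabs tau <= 2 * PI / 3 ->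
  dot2 (dev_direction tau) (dev_direction tau) = 3.
Proof.
  intros Htau. assert (Hc := cos_sector_ge tau Htau).
  pose_radicals tau.
  unfold dot2, dev_direction; simpl fst; simpl snd.
  field_simplify_eq; [|lra]. ring [Hw2 Hr2 Hs2 H2 H3].
Qed.

Lemma is_derive_dev_direction tau : Rabs tau < 2 * PI / 3 ->
  let c := cos tau in
  is_derive dev_direction tau
    (scal (sqrt 2 * c / (sqrt (1 + 2 * c) * sqrt (1 + c)))
       (perp (dev_direction tau))).
Proof.
  intros Htau c. assert (Hc := cos_sector_gt tau Htau).
  assert (Hw : 0 < sqrt (1 + 2 * cos tau)) by (apply sqrt_lt_R0; lra).
  pose_radicals tau.
  unfold perp, dev_direction, c; simpl fst; simpl snd.
  change (scal ?a (?x, ?y)) with (a * x, a * y).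
  assert (Hp : 0 < 9 * (1 + cos tau) * sqrt (1 + cos tau))
    by (apply Rmult_lt_0_compat; lra).
  apply is_derive_pair; auto_derive; repeat split; try lra.
  - field_simplify_eq; [|lra]. ring [Hw2 Hr2 Hs2 H2].
  - field_simplify_eq; [|lra]. ring [Hw2 Hr2 Hs2 H2].
Qed.

Lemma sqrt_one_minus_arccos_arg eps tau : eps * eps = 1 ->
  Rabs tau < 2 * PI / 3 -> 0 < eps * sin tau ->
  let c := cos tau in
  sqrt (1 - (sqrt 2 * c / sqrt (1 + c)) ^ 2)
  = eps * sin tau * sqrt (1 + 2 * c) / (1 + c).
Proof.
  intros Heps Htau Hs c. subst c.
  assert (Hc := cos_sector_gt tau Htau).
  assert (Hw : 0 < sqrt (1 + 2 * cos tau)) by (apply sqrt_lt_R0; lra).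
  pose_radicals tau.
  assert (He : eps ^ 2 = 1) by (rewrite <- Heps; ring).
  replace (1 - (sqrt 2 * cos tau / sqrt (1 + cos tau)) ^ 2)
    with ((eps * sin tau * sqrt (1 + 2 * cos tau) / (1 + cos tau)) ^ 2).
  - apply sqrt_pow2. apply Rdiv_le_0_compat; [|lra].
    apply Rmult_le_pos; lra.
  - field_simplify_eq; [|lra]. ring [Hw2 Hr2 Hs2 H2 He].
Qed.

(** The hypothesis on eps selects one side of 0: at 0 the arccosine reaches
    the end of its range, where it is not differentiable. *)
Lemma is_derive_arccos_term eps tau : eps * eps = 1 ->
  Rabs tau < 2 * PI / 3 -> 0 < eps * sin tau ->
  let c := cos tau in
  is_derive (fun x => acos (sqrt 2 * cos x / sqrt (1 + cos x))) tau
    (eps * (sqrt 2 * (2 + c) / (2 * sqrt (1 + c) * sqrt (1 + 2 * c)))).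
Proof.
  intros Heps Htau Hs c. subst c.
  assert (Hc := cos_sector_gt tau Htau).
  assert (Hw : 0 < sqrt (1 + 2 * cos tau)) by (apply sqrt_lt_R0; lra).
  pose_radicals tau.
  assert (He : eps ^ 2 = 1) by (rewrite <- Heps; ring).
  assert (Hroot := sqrt_one_minus_arccos_arg eps tau Heps Htau Hs).
  cbv zeta in Hroot.
  assert (Hpos : 0 < eps * sin tau * sqrt (1 + 2 * cos tau) / (1 + cos tau)).
  { apply Rdiv_lt_0_compat; [apply Rmult_lt_0_compat|]; lra. }
  set (X := sqrt 2 * cos tau / sqrt (1 + cos tau)) in *.
  (* The square root in Hroot is positive, so 1 - X ^ 2 is. *)
  assert (HX : -1 < X < 1).
  { destruct (Rle_dec (1 - X ^ 2) 0) as [Hle|Hlt].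
    - rewrite (sqrt_neg_0 _ Hle) in Hroot. lra.
    - nra. }
  assert (Hacos : is_derive acos X (- 1 / sqrt (1 - X ^ 2))).
  { apply is_derive_Reals.
    rewrite <- Rsqr_pow2, <- (derive_pt_acos X HX).
    apply (derive_pt_eq_1 _ _ _ (derivable_pt_acos X HX) eq_refl). }
  assert (HdX : is_derive (fun x => sqrt 2 * cos x / sqrt (1 + cos x)) tau
    (- sqrt 2 * sin tau * (2 + cos tau)
       / (2 * (1 + cos tau) * sqrt (1 + cos tau)))).
  { auto_derive; [repeat split; lra|].
    field_simplify_eq; [|lra]. ring [Hr2]. }
  assert (H := is_derive_comp acos
    (fun x => sqrt 2 * cos x / sqrt (1 + cos x)) tau _ _ Hacos HdX).
  rewrite Hroot in H.
  change (scal ?a ?b) with (a * b) in H.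
  assert (Heps0 : eps <> 0) by (intros ->; lra).
  assert (Hs0 : sin tau <> 0) by (intros H0; rewrite H0 in Hs; lra).
  replace (eps * _) with
    (- sqrt 2 * sin tau * (2 + cos tau)
       / (2 * (1 + cos tau) * sqrt (1 + cos tau))
       * (-1 / (eps * sin tau * sqrt (1 + 2 * cos tau) / (1 + cos tau))));
    [exact H|].
  field_simplify_eq; [|repeat split; lra]. ring [He].
Qed.

Lemma is_derive_dev_circle eps tau : eps * eps = 1 ->
  Rabs tau < 2 * PI / 3 -> 0 < eps * sin tau ->
  let c := cos tau in
  is_derive (dev_circle eps) tau
    (plus (scal (sin tau / (1 + c) / 3) (dev_direction tau))
       (scal (- (sqrt 2 * sqrt (1 + 2 * c) / sqrt (1 + c)) / 3)
          (perp (dev_direction tau)))).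
Proof.
  intros Heps Htau Hs c. assert (Hc := cos_sector_gt tau Htau).
  assert (Hacos := is_derive_arccos_term eps tau Heps Htau Hs).
  cbv zeta in Hacos.
  assert (Hw : 0 < sqrt (1 + 2 * cos tau)) by (apply sqrt_lt_R0; lra).
  pose_radicals tau.
  assert (He : eps ^ 2 = 1) by (rewrite <- Heps; ring).
  unfold perp, dev_direction, c; simpl fst; simpl snd.
  change (plus (scal ?a (?x, ?y)) (scal ?b (?u, ?v)))
    with (a * x + b * u, a * y + b * v).
  unfold dev_circle.
  apply is_derive_pair.
  - set (ac := fun x => acos (sqrt 2 * cos x / sqrt (1 + cos x))) in *.
    apply is_derive_ext with (fun x => 2 * sqrt 3 / 9 * (eps * ac x
      + sqrt 2 * sqrt (1 + 2 * cos x) * sin x / sqrt (1 + cos x)));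
      [reflexivity|].
    auto_derive.
    + repeat split; try lra. eexists; exact Hacos.
    + change (Derive _ tau) with (Derive ac tau).
      rewrite (is_derive_unique ac tau _ Hacos).
      field_simplify_eq; [|lra]. ring [Hw2 Hr2 Hs2 H2 He].
  - auto_derive.
    + repeat split; try lra. apply Rdiv_lt_0_compat; lra.
    + field_simplify_eq; [|lra]. ring [Hw2 Hr2 Hs2 H2].
Qed.

(** At a positive argument, 1 included, the arccosine is an arctangent; the
    reflection x -> - x gives the negative arguments. *)
Lemma continuous_acos x : continuous acos x.
Proof.
  assert (Hpos : forall y, 0 < y -> continuous acos y).
  { intros y Hy.
    apply continuous_ext_loc with (fun z => atan (sqrt (1 - Rsqr z) * / z)).
    - exists (mkposreal y Hy). intros z Hz. symmetry. apply acos_atan.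
      change (Rabs (z - y) < y) in Hz. apply Rabs_def2 in Hz. lra.
    - apply (continuous_comp (fun z => sqrt (1 - Rsqr z) * / z) atan).
      + apply continuous_Rmult.
        * apply (continuous_comp (fun z => 1 - Rsqr z) sqrt);
            [|apply continuous_sqrt].
          apply (ex_derive_continuous (V := R_NormedModule)).
          unfold Rsqr. auto_derive. trivial.
        * apply (ex_derive_continuous (V := R_NormedModule)).
          auto_derive. lra.
      + apply (ex_derive_continuous (V := R_NormedModule)).
        eexists. apply is_derive_atan. }
  destruct (Rlt_dec 0 x) as [Hx|Hx]; [now apply Hpos|].
  destruct (Rlt_dec x 0) as [Hx'|Hx'].
  - apply continuous_ext with (fun y => PI + - acos (- y)).
    { intros y. rewrite acos_opp.
      change (@eq R (PI + - (PI - acos y)) (acos y)). ring. }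
    apply continuous_Rplus; [apply continuous_const|].
    apply continuous_Ropp.
    apply (continuous_comp Ropp acos); [|apply Hpos; lra].
    apply (continuous_Ropp (fun y => y)), continuous_id.
  - assert (Hx0 : -1 < x < 1) by lra.
    apply continuity_pt_filterlim, derivable_continuous_pt.
    now apply derivable_pt_acos.
Qed.

Lemma continuous_dev_direction tau : Rabs tau <= 2 * PI / 3 ->
  continuous (fun x => fst (dev_direction x)) tau /\
  continuous (fun x => snd (dev_direction x)) tau.
Proof.
  intros Htau. assert (Hc := cos_sector_ge tau Htau).
  pose_radicals tau.
  unfold dev_direction; simpl. split.
  - assert (Ha : continuous (fun x => / (9 * (1 + cos x) * sqrt (1 + cos x)))
      tau).
    { apply (ex_derive_continuous (V := R_NormedModule)). auto_derive.
      repeat split; [lra|]. apply Rgt_not_eq, Rmult_lt_0_compat; lra. }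
    unfold Rdiv. prove_continuous.
  - apply (ex_derive_continuous (V := R_NormedModule)). auto_derive. lra.
Qed.

Lemma continuous_dev_circle eps tau : Rabs tau <= 2 * PI / 3 ->
  continuous (fun x => fst (dev_circle eps x)) tau /\
  continuous (fun x => snd (dev_circle eps x)) tau.
Proof.
  intros Htau. assert (Hc := cos_sector_ge tau Htau).
  pose_radicals tau.
  unfold dev_circle; simpl. split.
  - assert (Ha : continuous (fun x => / sqrt (1 + cos x)) tau).
    { apply (ex_derive_continuous (V := R_NormedModule)). auto_derive.
      repeat split; lra. }
    assert (Hacos : continuous
      (fun x => acos (sqrt 2 * cos x / sqrt (1 + cos x))) tau).
    { apply (continuous_comp (fun x => sqrt 2 * cos x / sqrt (1 + cos x)) acos);
        [|apply continuous_acos].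
      unfold Rdiv. prove_continuous. }
    unfold Rdiv in *. prove_continuous.
  - apply (ex_derive_continuous (V := R_NormedModule)). auto_derive.
    repeat split; try lra. apply Rdiv_lt_0_compat; lra.
Qed.

(** * Uniqueness of the development *)

Lemma continuous_development e_xi e_eta N D
    (HD : is_development e_xi e_eta N D) m b x :
  continuous (fun y => fst (D m (b + y))) x /\
  continuous (fun y => snd (D m (b + y))) x.
Proof.
  assert (H : continuous (fun y => D m (b + y)) x).
  { apply (continuous_comp_2 (fun _ : R => m) (fun y => b + y) D).
    - apply continuous_const.
    - apply continuous_Rplus; [apply continuous_const|apply continuous_id].
    - apply (dev_continuous _ _ _ _ HD). }
  split; [now apply continuous_fst_comp|now apply continuous_snd_comp].
Qed.

Lemma is_derive_shift {V : NormedModule R_AbsRing} (f : R -> V) (b x : R)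
    (l : V) :
  is_derive f (b + x) l -> is_derive (fun y => f (b + y)) x l.
Proof.
  intros Hf.
  rewrite <- (scal_one l).
  apply (is_derive_comp f (fun y => b + y) x l 1 Hf).
  auto_derive; trivial.
Qed.

Lemma dot2_eq_of_sqr (v w : R * R) :
  dot2 v v = 3 -> dot2 w w = 3 -> dot2 v w = 3 -> v = w.
Proof.
  destruct v as [a b], w as [x y]. unfold dot2; simpl. intros Hv Hw Hvw.
  assert (H : (a - x) ^ 2 + (b - y) ^ 2 = 0) by nra.
  assert (Hx := pow2_ge_0 (a - x)). assert (Hy := pow2_ge_0 (b - y)).
  f_equal; apply Rminus_diag_uniq, Rsqr_eq_0; unfold Rsqr; nra.
Qed.

(** Two plane vectors that rotate at the same speed keep their angle. *)
Lemma is_derive_dot2_rotating (f g : R -> R * R) (omega x : R) :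
  is_derive f x (scal omega (perp (f x))) ->
  is_derive g x (scal omega (perp (g x))) ->
  is_derive (fun y => dot2 (f y) (g y)) x 0.
Proof.
  intros Hf Hg.
  assert (Hf1 := is_derive_fst _ _ _ Hf).
  assert (Hf2 := is_derive_snd _ _ _ Hf).
  assert (Hg1 := is_derive_fst _ _ _ Hg).
  assert (Hg2 := is_derive_snd _ _ _ Hg).
  unfold dot2.
  evar_last.
  { apply (is_derive_plus (V := R_NormedModule)).
    - apply (is_derive_mult _ _ _ _ _ Hf1 Hg1 Rmult_comm).
    - apply (is_derive_mult _ _ _ _ _ Hf2 Hg2 Rmult_comm). }
  destruct (f x) as [a b], (g x) as [u v].
  unfold perp; simpl.
  change (omega * - b * u + a * (omega * - v)
          + (omega * a * v + b * (omega * u)) = 0).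
  ring.
Qed.

(** The tangential part of the velocity of D(m, t) is the same for all m and
    cancels between m = 1 and m = 0: the ruling only rotates. *)
Lemma is_derive_dev_ruling e_xi e_eta N D
    (HD : is_development e_xi e_eta N D) k tau :
  Rabs tau < 2 * PI / 3 ->
  let c := cos tau in
  let t := IZR k * (4 * PI / 3) + tau in
  dot3 (N t) (sector_normal k tau) = -1 ->
  is_derive (dev_ruling D) t
    (scal (sqrt 2 * c / (sqrt (1 + 2 * c) * sqrt (1 + c)))
       (perp (dev_ruling D t))).
Proof.
  intros Htau c t Hsigma. subst c.
  assert (Hc := cos_sector_gt tau Htau).
  assert (Hw : 0 < sqrt (1 + 2 * cos tau)) by (apply sqrt_lt_R0; lra).
  pose_radicals tau.
  assert (H1 := is_derive_development _ _ _ _ HD k 1 tau _ Htau Hsigma).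
  assert (H0 := is_derive_development _ _ _ _ HD k 0 tau _ Htau Hsigma).
  cbv zeta in H0, H1. fold t in H0, H1.
  assert (H := is_derive_minus _ _ _ _ _ H1 H0).
  replace (scal _ (perp _)) with
    (minus
       (plus (scal (sin tau / (1 + cos tau) / 3) (dev_ruling D t))
          (scal (-1 * (sqrt 2 * sqrt (1 + 2 * cos tau) / sqrt (1 + cos tau)
                         * (1 - 3 * cos tau * 1 / (1 + 2 * cos tau))) / 3)
             (perp (dev_ruling D t))))
       (plus (scal (sin tau / (1 + cos tau) / 3) (dev_ruling D t))
          (scal (-1 * (sqrt 2 * sqrt (1 + 2 * cos tau) / sqrt (1 + cos tau)
                         * (1 - 3 * cos tau * 0 / (1 + 2 * cos tau))) / 3)
             (perp (dev_ruling D t)))));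
    [exact H|].
  destruct (dev_ruling D t) as [x y]. unfold perp; simpl fst; simpl snd.
  change (minus (plus (scal ?a (?x, ?y)) (scal ?b (?u, ?v)))
                (plus (scal ?a (?x, ?y)) (scal ?d (?u, ?v))))
    with (a * x + b * u - (a * x + d * u), a * y + b * v - (a * y + d * v)).
  change (scal ?a (?x, ?y)) with (a * x, a * y).
  f_equal; (field_simplify_eq; [|repeat split; lra]); ring [Hw2].
Qed.

(** The odd coordinate vanishes at both ends, because of its factor
    sqrt (1 + 2 c). *)
Lemma dev_direction_glue :
  dev_direction (2 * PI / 3) = dev_direction (- (2 * PI / 3)).
Proof.
  assert (HPI := PI_RGT_0).
  unfold dev_direction. rewrite cos_neg, sin_neg.
  rewrite radical_end by (rewrite Rabs_pos_eq; lra).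
  f_equal. unfold Rdiv. ring.
Qed.

(** The developed ruling and [dev_direction] have the same length, rotate at
    the same speed and agree at t = 0. *)
Lemma developed_ruling e_xi e_eta N D (HN : unit_normal_field N)
    (Hf : plane_frame e_xi e_eta (N 0)) (HD : is_development e_xi e_eta N D) :
  forall k tau, Rabs tau <= 2 * PI / 3 ->
  dev_ruling D (IZR k * (4 * PI / 3) + tau) = dev_direction tau.
Proof.
  assert (HPI := PI_RGT_0).
  assert (Hsign := oriented_normal _ _ _ _ HN Hf HD).
  enough (Hdot : forall k tau, Rabs tau <= 2 * PI / 3 ->
    dot2 (dev_ruling D (IZR k * (4 * PI / 3) + tau)) (dev_direction tau) = 3).
  { intros k tau Htau. apply dot2_eq_of_sqr.
    - apply (dev_ruling_sqr _ _ _ _ HD).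
    - now apply dev_direction_sqr.
    - now apply Hdot. }
  apply (continuation (fun k tau =>
    dot2 (dev_ruling D (IZR k * (4 * PI / 3) + tau)) (dev_direction tau) = 3)).
  - rewrite Rmult_0_l, Rplus_0_l. unfold dev_ruling.
    rewrite !(dev_initial _ _ _ _ Hf HD).
    change (minus (0, ?x) (0, ?y)) with (0 - 0, x - y).
    unfold dot2, dev_direction; simpl fst; simpl snd.
    rewrite cos_0, sin_0.
    assert (H3 : sqrt 3 ^ 2 = 3) by (apply pow2_sqrt; lra).
    assert (Hr : 0 < sqrt (1 + 1)) by (apply sqrt_lt_R0; lra).
    field_simplify_eq; [|lra]. ring [H3].
  - intros k tau tau' Htau Htau' H. refine (eq_trans _ H).
    apply Rabs_le_between in Htau, Htau'.
    apply (zero_derivative_constant (fun x =>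
      dot2 (dev_ruling D (IZR k * (4 * PI / 3) + x)) (dev_direction x))
      (- (2 * PI / 3)) (2 * PI / 3)); try assumption.
    + intros x Hx. apply Rabs_lt_between in Hx.
      apply (is_derive_dot2_rotating
        (fun y => dev_ruling D (IZR k * (4 * PI / 3) + y)) dev_direction
        (sqrt 2 * cos x / (sqrt (1 + 2 * cos x) * sqrt (1 + cos x)))).
      * apply is_derive_shift.
        apply (is_derive_dev_ruling _ _ _ _ HD k x Hx
          (Hsign k x (Rlt_le _ _ Hx))).
      * apply is_derive_dev_direction, Hx.
    + intros x Hx. apply Rabs_le_between in Hx.
      destruct (continuous_dev_direction x Hx) as [Hd1 Hd2].
      destruct (continuous_development _ _ _ _ HD 0 (IZR k * (4 * PI / 3)) x)
        as [H01 H02].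
      destruct (continuous_development _ _ _ _ HD 1 (IZR k * (4 * PI / 3)) x)
        as [H11 H12].
      apply continuous_Rplus; apply continuous_Rmult; try assumption.
      * apply (continuous_minus _ _ _ H11 H01).
      * apply (continuous_minus _ _ _ H12 H02).
  - intros k. rewrite label_glue, dev_direction_glue. reflexivity.
Qed.

(** Since the rulings agree, so do the velocities of the two curves, and their
    difference is constant on every interval on which the sine keeps its
    sign. *)
Lemma dev_circle_half e_xi e_eta N D (HN : unit_normal_field N)
    (Hf : plane_frame e_xi e_eta (N 0)) (HD : is_development e_xi e_eta N D)
    k eps a b :
  eps * eps = 1 -> - (2 * PI / 3) <= a -> b <= 2 * PI / 3 ->
  (forall x, a < x < b -> 0 < eps * sin x) ->
  forall x y, a <= x <= b -> a <= y <= b ->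
  minus (D 0 (IZR k * (4 * PI / 3) + x)) (dev_circle eps x)
  = minus (D 0 (IZR k * (4 * PI / 3) + y)) (dev_circle eps y).
Proof.
  intros Heps Ha Hb Hs.
  assert (Hd : forall x, a < x < b ->
    is_derive
      (fun x => minus (D 0 (IZR k * (4 * PI / 3) + x)) (dev_circle eps x))
      x zero).
  { intros x Hx. assert (Hx' : Rabs x < 2 * PI / 3)
      by (apply Rabs_lt_between; lra).
    assert (Hc := cos_sector_gt x Hx').
    assert (Hw : 0 < sqrt (1 + 2 * cos x)) by (apply sqrt_lt_R0; lra).
    pose_radicals x.
    assert (Hsigma := oriented_normal _ _ _ _ HN Hf HD k x (Rlt_le _ _ Hx')).
    assert (HdD := is_derive_shift _ _ _ _
      (is_derive_development _ _ _ _ HD k 0 x _ Hx' Hsigma)).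
    assert (Hdc := is_derive_dev_circle eps x Heps Hx' (Hs x Hx)).
    cbv zeta in HdD, Hdc.
    rewrite (developed_ruling _ _ _ _ HN Hf HD) in HdD by lra.
    replace (-1 * (sqrt 2 * sqrt (1 + 2 * cos x) / sqrt (1 + cos x)
        * (1 - 3 * cos x * 0 / (1 + 2 * cos x))) / 3)
      with (- (sqrt 2 * sqrt (1 + 2 * cos x) / sqrt (1 + cos x)) / 3) in HdD
      by (field; lra).
    evar_last; [exact (is_derive_minus _ _ _ _ _ HdD Hdc)|].
    exact (minus_eq_zero
      (G := prod_NormedModule R_AbsRing R_NormedModule R_NormedModule) _). }
  assert (Hcont : forall x, a <= x <= b ->
    continuous (fun x =>
      fst (D 0 (IZR k * (4 * PI / 3) + x)) - fst (dev_circle eps x)) x /\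
    continuous (fun x =>
      snd (D 0 (IZR k * (4 * PI / 3) + x)) - snd (dev_circle eps x)) x).
  { intros x Hx.
    destruct (continuous_dev_circle eps x) as [H1 H2];
      [apply Rabs_le_between; lra|].
    destruct (continuous_development _ _ _ _ HD 0 (IZR k * (4 * PI / 3)) x)
      as [H3 H4].
    split; now apply (continuous_minus (V := R_NormedModule)). }
  intros x y Hx Hy.
  rewrite (surjective_pairing (minus (D 0 (_ + x)) _)),
    (surjective_pairing (minus (D 0 (_ + y)) _)).
  f_equal.
  - apply (zero_derivative_constant (fun z =>
      fst (D 0 (IZR k * (4 * PI / 3) + z)) - fst (dev_circle eps z)) a b);
      try assumption.
    + intros z Hz. apply (is_derive_fst _ _ _ (Hd z Hz)).
    + intros z Hz. apply (Hcont z Hz).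
  - apply (zero_derivative_constant (fun z =>
      snd (D 0 (IZR k * (4 * PI / 3) + z)) - snd (dev_circle eps z)) a b);
      try assumption.
    + intros z Hz. apply (is_derive_snd _ _ _ (Hd z Hz)).
    + intros z Hz. apply (Hcont z Hz).
Qed.

Lemma dev_circle_apex eps eps' : dev_circle eps 0 = dev_circle eps' 0.
Proof.
  assert (Hs : 0 < sqrt 2) by (apply sqrt_lt_R0; lra).
  unfold dev_circle. rewrite cos_0.
  replace (sqrt 2 * 1 / sqrt (1 + 1)) with 1.
  - rewrite acos_1, !Rmult_0_r. reflexivity.
  - replace (1 + 1) with 2 by ring. field. lra.
Qed.

(** The translation vector of the periodic development. *)
Lemma dev_circle_glue :
  dev_circle 1 (2 * PI / 3)
  = plus (4 * PI / (3 * sqrt 3), 0) (dev_circle (-1) (- (2 * PI / 3))).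
Proof.
  assert (HPI := PI_RGT_0).
  assert (H2 : sqrt 2 ^ 2 = 2) by (apply pow2_sqrt; lra).
  assert (H3 : sqrt 3 ^ 2 = 3) by (apply pow2_sqrt; lra).
  assert (H2p : 0 < sqrt 2) by (apply sqrt_lt_R0; lra).
  assert (H3p : 0 < sqrt 3) by (apply sqrt_lt_R0; lra).
  assert (Hc : cos (2 * PI / 3) = -1 / 2).
  { rewrite <- cos_2PI3. f_equal. field. }
  assert (Hacos : acos (sqrt 2 * (-1 / 2) / sqrt (1 + -1 / 2)) = PI).
  { replace (sqrt 2 * (-1 / 2) / sqrt (1 + -1 / 2)) with (- (1)).
    - rewrite acos_opp, acos_1. ring.
    - replace (1 + -1 / 2) with (/ 2) by field. rewrite sqrt_inv.
      field_simplify_eq; [|lra]. ring [H2]. }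
  assert (Hr : 0 < sqrt (1 + -1 / 2)) by (apply sqrt_lt_R0; lra).
  unfold dev_circle.
  change (plus (?a, ?b) (?x, ?y)) with (a + x, b + y).
  rewrite cos_neg, radical_end by (rewrite Rabs_pos_eq; lra).
  rewrite Hc, Hacos. f_equal; [|ring].
  field_simplify_eq; [|lra]. ring [H3].
Qed.

(** Each half of a sector is treated with its own sign eps; the halves fit
    together at tau = 0 because the arccosine vanishes there. *)
Lemma developed_circle e_xi e_eta N D (HN : unit_normal_field N)
    (Hf : plane_frame e_xi e_eta (N 0)) (HD : is_development e_xi e_eta N D) :
  forall k tau, Rabs tau <= 2 * PI / 3 ->
  minus (D 0 (IZR k * (4 * PI / 3) + tau)) (dev_circle (sign tau) tau)
  = (IZR k * (4 * PI / (3 * sqrt 3)), 0).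
Proof.
  assert (HPI := PI_RGT_0).
  set (Q k tau :=
    minus (D 0 (IZR k * (4 * PI / 3) + tau)) (dev_circle (sign tau) tau)
    = (IZR k * (4 * PI / (3 * sqrt 3)), 0)).
  apply (continuation Q); unfold Q.
  - rewrite Rmult_0_l, Rplus_0_l, (dev_initial _ _ _ _ Hf HD), sign_0.
    unfold dev_circle. rewrite sin_0, cos_0.
    replace (2 / (1 + 1)) with 1 by field. rewrite ln_1.
    change (minus (?a, ?b) (?x, ?y)) with (a - x, b - y).
    unfold Rdiv. f_equal; ring.
  - assert (Hhalf : forall k tau, Rabs tau <= 2 * PI / 3 ->
      minus (D 0 (IZR k * (4 * PI / 3) + tau)) (dev_circle (sign tau) tau)
      = minus (D 0 (IZR k * (4 * PI / 3) + 0)) (dev_circle (sign 0) 0)).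
    { intros k tau Htau. apply Rabs_le_between in Htau.
      destruct (Rtotal_order tau 0) as [Hneg|[->|Hpos]].
      - rewrite (sign_eq_m1 _ Hneg), (dev_circle_apex (sign 0) (-1)).
        apply (dev_circle_half _ _ _ _ HN Hf HD k (-1)
          (- (2 * PI / 3)) 0); try lra.
        intros x Hx. assert (0 < sin (- x)) by (apply sin_gt_0; lra).
        rewrite sin_neg in H. lra.
      - reflexivity.
      - rewrite (sign_eq_1 _ Hpos), (dev_circle_apex (sign 0) 1).
        apply (dev_circle_half _ _ _ _ HN Hf HD k 1 0 (2 * PI / 3)); try lra.
        intros x Hx. rewrite Rmult_1_l. apply sin_gt_0; lra. }
    intros k tau tau' Htau Htau' H.
    now rewrite Hhalf, <- (Hhalf k tau).
  - intros k. rewrite label_glue.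
    rewrite (sign_eq_1 (2 * PI / 3)), (sign_eq_m1 (- (2 * PI / 3))) by lra.
    rewrite dev_circle_glue, succ_IZR.
    destruct (D 0 _) as [x y], (dev_circle (-1) _) as [u v].
    change (minus (x, y) (plus (?a, ?b) (u, v)))
      with (x - (a + u), y - (b + v)).
    change (minus (x, y) (u, v)) with (x - u, y - v).
    split; intros H; injection H; intros Hy Hx; f_equal; lra.
Qed.

(** * The developed edge of regression *)

Lemma sector_injective k m m' tau : - (1 / 2) <= cos tau ->
  sector k m tau = sector k m' tau -> m = m'.
Proof.
  intros Hc H.
  unfold sector, omega2 in H.
  injection H; intros _ H2 _.
  assert (Hfac : (m - m') * (1 + cos tau + cos tau ^ 2) = 0).
  { transitivity (((1 - m) * (- (1 / 2) - cos tau)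
        + m * (1 / 2 - cos tau / (1 + cos tau))
        - ((1 - m') * (- (1 / 2) - cos tau)
           + m' * (1 / 2 - cos tau / (1 + cos tau)))) * (1 + cos tau)).
    - field. lra.
    - rewrite H2. ring. }
  apply Rmult_integral in Hfac. destruct Hfac; nra.
Qed.

Lemma sign_mult_abs_sin x : Rabs x <= 2 * PI / 3 ->
  sign x * Rabs (sin x) = sin x.
Proof.
  intros Hx. assert (HPI := PI_RGT_0). apply Rabs_le_between in Hx.
  destruct (Rtotal_order x 0) as [Hneg|[->|Hpos]].
  - assert (H : 0 < sin (- x)) by (apply sin_gt_0; lra).
    rewrite sin_neg in H. rewrite (sign_eq_m1 _ Hneg), Rabs_left by lra. ring.
  - rewrite sin_0, sign_0. ring.
  - assert (H : 0 < sin x) by (apply sin_gt_0; lra).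
    rewrite (sign_eq_1 _ Hpos), Rabs_pos_eq by lra. ring.
Qed.

(** In the product sign tau * g1_tilde tau the sign remains visible only at the
    arccosine: in the second term sign tau * |sin tau| = sin tau. *)
Lemma developed_edge_formula tau : Rabs tau <= 2 * PI / 3 -> cos tau <> 0 ->
  plus (dev_circle (sign tau) tau)
    (scal ((1 + 2 * cos tau) / (3 * cos tau)) (dev_direction tau))
  = (sign tau * g1_tilde tau, g2_tilde tau).
Proof.
  intros Htau Hc0. assert (Hc := cos_sector_ge tau Htau).
  assert (Hw : sqrt (2 * (1 + 2 * cos tau))
               = sqrt 2 * sqrt (1 + 2 * cos tau)) by (apply sqrt_mult; lra).
  pose_radicals tau.
  unfold dev_circle, dev_direction, g1_tilde, g2_tilde. cbv zeta.
  change (plus (?a, ?b) (scal ?l (?x, ?y))) with (a + l * x, b + l * y).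
  rewrite Hw. f_equal.
  - assert (Hs := sign_mult_abs_sin tau Htau).
    field_simplify_eq; [|repeat split; lra]. ring [Hr2 Hs].
  - field. repeat split; lra.
Qed.

Lemma development_of_edge e_xi e_eta N D (HN : unit_normal_field N)
    (Hf : plane_frame e_xi e_eta (N 0)) (HD : is_development e_xi e_eta N D)
    m t :
  cos (h t) <> 0 -> surface m t = edge t -> D m t = (g1_star t, g2_star t).
Proof.
  intros Hc0 Hedge.
  destruct (label_exists t) as [k [Hk [Ht Hh]]].
  assert (Hc := cos_sector_ge _ Hh).
  assert (Hm : m = (1 + 2 * cos (h t)) / (3 * cos (h t))).
  { apply (sector_injective k _ _ (h t) Hc).
    rewrite <- surface_sector, <- edge_sector, <- Ht by assumption.
    exact Hedge. }
  rewrite (dev_affine _ _ _ _ HD).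
  assert (HV := developed_ruling _ _ _ _ HN Hf HD k (h t) Hh).
  assert (HA := developed_circle _ _ _ _ HN Hf HD k (h t) Hh).
  rewrite <- Ht in HV, HA. rewrite HV, Hm.
  assert (HE := developed_edge_formula _ Hh Hc0).
  unfold g1_star, g2_star. rewrite Hk.
  destruct (D 0 t) as [x y], (dev_circle _ _) as [a b],
    (dev_direction _) as [u v].
  change (minus (x, y) (a, b)) with (x - a, y - b) in HA.
  change (plus (?a, ?b) (scal ?l (?x, ?y)))
    with (a + l * x, b + l * y) in HE |- *.
  injection HA; injection HE; intros. f_equal; lra.
Qed.

Theorem theorem7 (e_xi e_eta : R * R * R) (N : R -> R * R * R)
    (D : R -> R -> R * R)
    (HN : unit_normal_field N)
    (Hframe : plane_frame e_xi e_eta (N 0))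
    (HD : is_development e_xi e_eta N D) :
  (forall p : R * R,
     developed_edge D p <->
     exists t : R, cos (h t) <> 0 /\ p = (g1_star t, g2_star t))
  /\
  (forall m t : R, cos (h t) <> 0 -> surface m t = edge t ->
     D m t = (g1_star t, g2_star t)).
Proof.
  assert (Hformula := fun m t =>
    development_of_edge e_xi e_eta N D HN Hframe HD m t).
  split; [|exact Hformula].
  intros p; split.
  - intros [m [t [Hdef [Hedge ->]]]]. exists t.
    destruct (label_exists t) as [k [_ [Ht Hh]]].
    assert (Hc0 : cos (h t) <> 0).
    { rewrite Ht in Hdef. now apply edge_defined_sector in Hdef. }
    split; [exact Hc0|now apply Hformula].
  - intros [t [Hc0 ->]].
    destruct (label_exists t) as [k [_ [Ht Hh]]].
    assert (Hedge : surface ((1 + 2 * cos (h t)) / (3 * cos (h t))) t = edge t).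
    { rewrite Ht at 3 4. rewrite surface_sector, edge_sector by assumption.
      reflexivity. }
    exists ((1 + 2 * cos (h t)) / (3 * cos (h t))), t.
    split; [|split; [exact Hedge|symmetry; now apply Hformula]].
    rewrite Ht. now apply edge_defined_sector.
Qed.
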